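(* Let $W$ be a finite Coxeter group and $c$ a Coxeter element of $W$. Every open interval $(u,v)$ in the $c$-Cambrian lattice of $W$ has order complex homotopy equivalent to a ball or a sphere of some dimension.
   Context: The $c$-Cambrian lattice of a finite Coxeter group $W$ with Coxeter element $c$ (Reading) is the restriction of the right weak order on $W$ to the $c$-sortable elements of $W$ (equivalently, the lattice quotient of the weak order on $W$ by the $c$-Cambrian congruence). For $W=S_n$ and suitable $c$ it is the Tamari lattice. The order complex of a poset is the simplicial complex of its chains, and $(u,v)=\{z:u<z<v\}$. *)

(* Defs.v *)
From HB Require Import structures.
From mathcomp Require Import all_boot all_order all_algebra all_fingroup.
From mathcomp Require Import all_classical all_reals all_analysis.
Import Order.TTheory GRing.Theory Num.Theory numFieldNormedType.Exports.

Set Implicit Arguments.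
Unset Strict Implicit.
Unset Printing Implicit Defensive.

Local Open Scope classical_set_scope.
Local Open Scope ring_scope.

(* Coxeter systems.  The simple reflections are a family [s : I -> W]. *)

(* [m i j = 0] encodes the label infinity. *)
Definition coxeter_matrix (I : finType) (m : I -> I -> nat) : Prop :=
  [/\ forall i, m i i = 1%N,
      forall i j, m i j = m j i
    & forall i j, i != j -> m i j != 1%N].

(* Congruence on words generated by (i j)^(m i j) ~ 1.  Since [m i i = 1], the
   relation for i = j is i i ~ 1, so words suffice to present a group. *)
Inductive coxeter_equiv (I : finType) (m : I -> I -> nat) :
    seq I -> seq I -> Prop :=
| coxeter_equiv_refl a : coxeter_equiv m a a
| coxeter_equiv_sym a b : coxeter_equiv m a b -> coxeter_equiv m b a
| coxeter_equiv_trans a b d :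
    coxeter_equiv m a b -> coxeter_equiv m b d -> coxeter_equiv m a d
| coxeter_equiv_rel i j a b :
    coxeter_equiv m (a ++ flatten (nseq (m i j) [:: i; j]) ++ b) (a ++ b).

Definition wprod (I : finType) (W : finGroupType) (s : I -> W) (a : seq I) : W :=
  (\prod_(i <- a) s i)%g.

(* (W, s) is presented by < I | (i j)^(m i j) = 1 >. *)
Definition coxeter_system (I : finType) (W : finGroupType)
    (m : I -> I -> nat) (s : I -> W) : Prop :=
  [/\ coxeter_matrix m,
      forall w : W, exists a, wprod s a = w
    & forall a b, wprod s a = wprod s b <-> coxeter_equiv m a b].

Definition reduced_word (I : finType) (W : finGroupType) (s : I -> W)
    (w : W) (a : seq I) : Prop :=
  wprod s a = w /\ forall b, wprod s b = w -> (size a <= size b)%N.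

(* Right weak order: some reduced word of u is a prefix of one of v. *)
Definition weak_le (I : finType) (W : finGroupType) (s : I -> W) : rel W :=
  fun u v => `[< exists a b, reduced_word s u a /\ reduced_word s v (a ++ b) >].

Definition weak_lt (I : finType) (W : finGroupType) (s : I -> W) : rel W :=
  fun u v => (u != v) && weak_le s u v.

(* [c] is a Coxeter element, with reduced word [a]: each simple reflection
   occurs exactly once in [a], in an arbitrary order. *)
Definition coxeter_word (I : finType) (W : finGroupType) (s : I -> W)
    (c : W) (a : seq I) : Prop :=
  perm_eq a (enum I) /\ wprod s a = c.

(* A letter of the half-infinite word a^oo = a a a ... is given as [(k, i)]:
   the letter [i] in the k-th copy of [a], at position [a_pos a (k, i)]. *)
Definition a_pos (I : finType) (a : seq I) (q : nat * I) : nat :=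
  (q.1 * size a + index q.2 a)%N.

Definition reduced_subword (I : finType) (W : finGroupType) (s : I -> W)
    (a : seq I) (w : W) (p : seq (nat * I)) : Prop :=
  sorted ltn (map (a_pos a) p) /\ reduced_word s w (map snd p).

(* The c-sorting word: the subword of a^oo, leftmost in lexicographic order of
   positions, among those that are reduced words for w. *)
Definition sorting_word (I : finType) (W : finGroupType) (s : I -> W)
    (a : seq I) (w : W) (p : seq (nat * I)) : Prop :=
  reduced_subword s a w p /\
  forall p', reduced_subword s a w p' ->
    ((map (a_pos a) p : seqlexi nat) <= (map (a_pos a) p' : seqlexi nat))%O.

Definition block (I : finType) (p : seq (nat * I)) (k : nat) : {set I} :=
  [set i | (k, i) \in p]%SET.

(* Reading's definition fixes a reduced word [a] for the Coxeter element c
   beforehand; the resulting set of c-sortable elements depends only on c. *)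
Definition sortable (I : finType) (W : finGroupType) (s : I -> W)
    (a : seq I) (w : W) : Prop :=
  exists2 p, sorting_word s a w p & forall k, block p k.+1 \subset block p k.

(* Open interval of the weak order restricted to the c-sortable elements. *)
Definition cambrian_interval (I : finType) (W : finGroupType) (s : I -> W)
    (a : seq I) (u v : W) : {set W} :=
  [set z | [&& `[< sortable s a z >], weak_lt s u z & weak_lt s z v]]%SET.

(* Simplicial complexes, as sets of faces including the empty one. *)

Definition order_complex (T : finType) (le : rel T) (X : {set T}) :
    {set {set T}} :=
  [set A : {set T} | (A \subset X) &&
     [forall x in A, forall y in A, le x y || le y x]]%SET.

(* Geometric realization, in barycentric coordinates indexed by [enum_rank]. *)
Definition realization (R : realType) (T : finType) (K : {set {set T}}) :
    set 'rV[R]_#|T| :=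
  [set x | [/\ forall t : T, 0 <= x ord0 (enum_rank t),
               \sum_(t : T) x ord0 (enum_rank t) = 1
             & [set t : T | x ord0 (enum_rank t) != 0]%SET \in K]].
Arguments realization R {T} K.

(* The closed unit ball of R^n, and the unit sphere of R^n, i.e. the sphere of
   dimension n - 1; for n = 0 they are a point and the empty space. *)
Definition unit_ball (R : realType) (n : nat) : set 'rV[R]_n :=
  [set x | \sum_(i < n) x ord0 i ^+ 2 <= 1].

Definition unit_sphere (R : realType) (n : nat) : set 'rV[R]_n :=
  [set x | \sum_(i < n) x ord0 i ^+ 2 = 1].
Arguments unit_ball R n : clear implicits.
Arguments unit_sphere R n : clear implicits.

(* A homotopy is [H : R * X -> Y]; only its values on [0, 1] * X matter. *)
Definition homotopic (R : realType) (X Y : topologicalType) (f g : X -> Y) :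
    Prop :=
  exists H : R * X -> Y,
    [/\ {within `[0, 1] `*` setT, continuous H},
        forall x, H (0, x) = f x
      & forall x, H (1, x) = g x].

Definition homotopy_equivalent (R : realType) (X Y : topologicalType) : Prop :=
  exists (f : X -> Y) (g : Y -> X),
    [/\ continuous f, continuous g,
        homotopic R (g \o f) idfun & homotopic R (f \o g) idfun].

(* Main.v *)
(* Let [s] be the first letter of the Coxeter word [a], and [J] the set of the
   other letters. A sortable element either lies above [s], and deleting [s]
   makes it sortable for the word rotated by one letter, or it is a sortable
   element of [W_J].
   The join in the weak order of two sortable elements is sortable, by induction
   on the length of an upper bound and on the rank. The case that this recursion
   does not reach is [s \/ y] with [y] in [W_J]: there one rotates the second
   letter instead, which yields sortability for a word with [s] in last position,
   and the skew form of the Coxeter element, which has constant sign on the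
   inversions of a sortable element taken in order, allows one to move [s] to the
   front.
   Let [u] not lie above [s], let [v] lie above [s], and let [r z] be the largest
   sortable element of [W_J] below [z]. Among the sortable elements of [[u, v]],
   those above [s] retract by [r] onto [[u, r v]], with section [x |-> s \/ x].
   Hence, recursively, [[u, v]] retracts onto a Boolean lattice [B] through a
   decreasing map [z |-> psi (phi z)]. If the top of [B] is not [v], the open
   interval is contractible; otherwise it deforms onto the proper part of [B],
   whose order complex is a sphere. *)
Require Import Defs.
From mathcomp Require Import all_boot all_order all_algebra all_fingroup.
From mathcomp Require Import all_classical all_reals all_analysis.
From mathcomp Require Import ring lra zify.
Import Order.TTheory GRing.Theory Num.Theory numFieldNormedType.Exports.

Set Implicit Arguments.
Unset Strict Implicit.
Unset Printing Implicit Defensive.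

Local Open Scope ring_scope.

(** * The geometric representation *)

(** Reduced words are hard to compare directly, so the weak order is read off inversion sets: signs
    of roots turn statements about words into inequalities between coordinates, and since [W_J]
    fixes the coordinates outside [J], its elements have all their inversions supported on [J].
    Sortability is restated as a word produced by reading the letters cyclically, a dropped letter
    never returning; this inductive form follows the rotation of the Coxeter word. The crux of the
    retraction is [r (s \/ x) = x] for sortable [x] in [W_J]. It holds because some element above
    both [s] and [x] has above [x] no further element of [W_J] below it. The Boolean lattice thus
    gains one coordinate, telling whether an element lies above [s]. The homotopies are explicit
    formulas in barycentric coordinates. Pushing mass down a chain starting from its bottom keeps
    the support a chain at all times. The proper part of a Boolean lattice matches a sphere through
    functions on its atoms modulo constants, whose upper level sets form a chain. *)

Section DihedralSequences.
Variable R : realType.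

Lemma sin_step (t : R) (k : nat) :
  sin (k.+2%:R * t) = 2 * cos t * sin (k.+1%:R * t) - sin (k%:R * t).
Proof.
have -> : k.+2%:R * t = k.+1%:R * t + t by rewrite -[k.+2]addn1 natrD; ring.
have -> : k%:R * t = k.+1%:R * t - t by rewrite -[k.+1]addn1 natrD; ring.
by rewrite sinD sinB; ring.
Qed.

Lemma sin_pi_div_gt0 (n : nat) : (1 < n)%N -> 0 < sin (pi / n%:R : R).
Proof.
move=> n1; apply: sin_gt0_pi; have n0 : 0 < n%:R :> R by rewrite ltr0n; lia.
rewrite divr_gt0 ?pi_gt0 //= ltr_pdivrMr // ltr_pMr ?pi_gt0 //.
by rewrite ltr1n.
Qed.

(** Solutions of the recursion are spanned by [sin (k t)] and [sin ((k - 1) t)] with [t = pi / n].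
    The factor [sin t], nonzero for [1 < n], clears the denominator. *)
Lemma sin_rec_closed (n : nat) (e : nat -> R) :
  (1 < n)%N ->
  (forall k, e k.+2 = 2 * cos (pi / n%:R) * e k.+1 - e k) ->
  forall k, sin (pi / n%:R) * e k =
    e 1%N * sin (k%:R * (pi / n%:R)) - e 0%N * sin (k%:R * (pi / n%:R) - pi / n%:R).
Proof.
move=> n1 he; set t := pi / n%:R.
suff H k : sin t * e k = e 1%N * sin (k%:R * t) - e 0%N * sin (k%:R * t - t) /\
    sin t * e k.+1 = e 1%N * sin (k.+1%:R * t) - e 0%N * sin (k.+1%:R * t - t).
  by move=> k; case: (H k).
elim: k => [|k [IH1 IH2]].
  by rewrite !mul0r !mul1r sin0 sub0r subrr sin0 sinN; split; ring.
split=> //; rewrite he -/t mulrBr mulrCA IH1 IH2 sin_step.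
have -> : k.+2%:R * t - t = k.+1%:R * t by rewrite -[k.+2]addn1 natrD; ring.
have E : k.+1%:R * t - t = k%:R * t by rewrite -[k.+1]addn1 natrD; ring.
rewrite E.
have -> : sin (k.+1%:R * t) = sin (k%:R * t + t).
  by congr sin; rewrite -[k.+1]addn1 natrD; ring.
by rewrite sinB sinD; ring.
Qed.

Lemma sin_rec_periodic (n : nat) (e : nat -> R) :
  (1 < n)%N ->
  (forall k, e k.+2 = 2 * cos (pi / n%:R) * e k.+1 - e k) ->
  forall k, e (k + 2 * n)%N = e k.
Proof.
move=> n1 he k; have s0 := sin_pi_div_gt0 n1.
apply: (mulfI (lt0r_neq0 s0)); rewrite !(sin_rec_closed n1 he).
have n0 : n%:R != 0 :> R by rewrite pnatr_eq0; lia.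
have -> : (k + 2 * n)%N%:R * (pi / n%:R) = k%:R * (pi / n%:R) + pi *+ 2 :> R.
  by rewrite natrD natrM mulrDl -[pi *+ 2]mulr_natl; field.
by rewrite addrAC !sinD2pi.
Qed.

(* [4 - (2 cos t)^2 = 4 sin^2 t], and the step-two recursion of [e] multiplies
   a sum over a full period by [(2 cos t)^2 - 2] while it also equals twice it. *)
Lemma sin_rec_sum0 (n : nat) (e : nat -> R) :
  (1 < n)%N ->
  (forall k, e k.+2 = 2 * cos (pi / n%:R) * e k.+1 - e k) ->
  \sum_(k < n) e (2 * k)%N = 0.
Proof.
move=> n1 he; have per := sin_rec_periodic n1 he.
set K := 2 * cos _ in he.
have H k : e (k + 4)%N + e k = (K ^+ 2 - 2) * e (k + 2)%N.
  rewrite addn4 addn2 he (he k.+1) (he k); ring.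
have sh c : \sum_(k < n) e (2 * (k + c))%N = \sum_(k < n) e (2 * k)%N.
  elim: c => [|c IH]; first by apply: eq_bigr => k _; rewrite addn0.
  rewrite -IH; case: (n) n1 per => // n' _ per.
  rewrite big_ord_recr [RHS]big_ord_recl /= addrC; congr (_ + _).
    by rewrite -(per (2 * (0 + c))%N); congr e; lia.
  by apply: eq_bigr => k _; rewrite /bump /=; congr e; lia.
set S := \sum_(k < n) _.
have E : S + S = (K ^+ 2 - 2) * S.
  transitivity (\sum_(k < n) (e (2 * (k + 2))%N + e (2 * k)%N)).
    by rewrite big_split /= sh.
  rewrite /S -(sh 1%N) big_distrr /=.
  apply: eq_bigr => k _.
  have -> : (2 * (k + 2) = 2 * k + 4)%N by lia.
  have -> : (2 * (k + 1) = 2 * k + 2)%N by lia.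
  exact: H.
have s0 := sin_pi_div_gt0 n1.
have F : 4 * sin (pi / n%:R : R) ^+ 2 * S = 0.
  rewrite sin2cos2; have : S + S - (K ^+ 2 - 2) * S = 0 by rewrite -E subrr.
  by rewrite /K => <-; ring.
move/eqP: F; rewrite mulf_eq0 => /orP[|/eqP //].
by rewrite mulf_eq0 expf_eq0 /= (gt_eqF s0) pnatr_eq0.
Qed.

(** The Chebyshev polynomial of the second kind of index [k - 1] at [K / 2]: it equals
    [sin (k t) / sin t] for [K = 2 cos t] and [k] for [K = 2]. These are the coordinates of the
    roots of a dihedral group in its two simple roots. *)
Fixpoint dihedral_coef (K : R) (k : nat) : R :=
  if k is k1.+1 then
    if k1 is k2.+1 then K * dihedral_coef K k1 - dihedral_coef K k2 else 1
  else 0.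

Lemma dihedral_coefS K k : dihedral_coef K k.+2 =
  K * dihedral_coef K k.+1 - dihedral_coef K k.
Proof. by []. Qed.

Lemma dihedral_coef_ge0 (n k : nat) : (1 < n)%N -> (k <= n)%N ->
  0 <= dihedral_coef (2 * cos (pi / n%:R)) k.
Proof.
move=> n1 kn; have s0 := sin_pi_div_gt0 n1.
have := sin_rec_closed n1 (dihedral_coefS (2 * cos (pi / n%:R))) k.
rewrite /= mul0r subr0 mul1r => E.
rewrite -(pmulr_rge0 _ s0) E; apply: sin_ge0_pi.
have n0 : 0 < n%:R :> R by rewrite ltr0n; lia.
rewrite mulr_ge0 ?divr_ge0 ?pi_ge0 //= mulrCA ger_pMr ?pi_gt0 //.
by rewrite ler_pdivrMr // mul1r ler_nat.
Qed.

Lemma dihedral_coef_ge0_inf k : 0 <= dihedral_coef 2 k.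
Proof.
suff : dihedral_coef 2 k = k%:R /\ dihedral_coef 2 k.+1 = k.+1%:R.
  by case=> -> _; rewrite ler0n.
elim: k => [|k [IH1 IH2]]; first by [].
by split=> //; rewrite dihedral_coefS IH1 IH2 -[k.+2]addn2 -[k.+1]addn1 !natrD; ring.
Qed.

End DihedralSequences.

(* When [C] is an interval with bottom [u] and [D] the set of its atoms, [phi z]
   stands for the atoms below [z] and [psi A] for the join of [A]. *)
Record boolean_retract (T K : finType) (le : T -> T -> Prop) (C : T -> Prop) (u : T)
    (D : {set K}) (phi : T -> {set K}) (psi : {set K} -> T) : Prop := {
  retract_sub : forall z, C z -> phi z \subset D;
  retract_homo : forall z z', C z -> C z' -> le z z' -> phi z \subset phi z';
  section_in : forall A : {set K}, A \subset D -> C (psi A);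
  section_homo : forall A B : {set K}, B \subset D -> A \subset B -> le (psi A) (psi B);
  section_le : forall z, C z -> le (psi (phi z)) z;
  sectionK : forall A : {set K}, A \subset D -> phi (psi A) = A;
  retract_bot : forall z, C z -> phi z = finset.set0 -> z = u;
  section_bot : psi finset.set0 = u
}.

Section GeometricRepresentation.
Variables (R : realType) (I : finType) (W : finGroupType).
Variables (m : I -> I -> nat) (s : I -> W).
Hypothesis hW : coxeter_system m s.

Let m_diag i : m i i = 1%N.
Proof. by have [[? ? ?] _ _] := hW; auto. Qed.
Let m_sym i j : m i j = m j i.
Proof. by have [[? ? ?] _ _] := hW; auto. Qed.
Let m_off i j : i != j -> m i j != 1%N.
Proof. by have [[? ? ?] _ _] := hW; auto. Qed.

Notation V := {ffun I -> R}.
Notation wp := (wprod s).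

(** Twice the Tits form, so that every root has norm 2. The label infinity, coded by 0, gets the
    limit -2 of the cosine formula. *)
Definition cartan (i j : I) : R :=
  if i == j then 2 else if m i j == 0%N then - 2
  else - (2 * cos (pi / (m i j)%:R)).

Lemma cartan_sym i j : cartan i j = cartan j i.
Proof. by rewrite /cartan eq_sym m_sym. Qed.

Lemma cartan_diag i : cartan i i = 2.
Proof. by rewrite /cartan eqxx. Qed.

Lemma m_gt1 i j : i != j -> m i j != 0%N -> (1 < m i j)%N.
Proof. by move=> /m_off; lia. Qed.

Lemma cartan_le0 i j : i != j -> cartan i j <= 0.
Proof.
move=> ij; rewrite /cartan (negPf ij); case: eqP => [_|/eqP m0]; first by lra.
have m1 := m_gt1 ij m0.
rewrite oppr_le0 mulr_ge0 //; apply: cos_ge0_pihalf.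
have p0 := pi_gt0 R; have mm : 0 < (m i j)%:R :> R by rewrite ltr0n; lia.
apply/andP; split.
  by apply: (@le_trans _ _ (0 : R)); [rewrite oppr_le0 divr_ge0 // ltW | rewrite divr_ge0 // ltW].
by rewrite ler_pM2l // lef_pV2 ?posrE // ler_nat.
Qed.

Lemma cartan_eq0 i j : i != j -> cartan i j = 0 -> m i j = 2%N.
Proof.
move=> ij; rewrite /cartan (negPf ij); case: eqP => [_ E|/eqP m0].
  by exfalso; lra.
move=> E; have m1 := m_gt1 ij m0.
apply/eqP; apply: contraT => m2.
have m3 : (2 < m i j)%N by lia.
suff : 0 < cos (pi / (m i j)%:R : R) by lra.
apply: cos_gt0_pihalf; have p0 := pi_gt0 R.
have mm : 0 < (m i j)%:R :> R by rewrite ltr0n; lia.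
apply/andP; split.
  by apply: (@lt_trans _ _ (0 : R)); [rewrite oppr_lt0 divr_gt0 | rewrite divr_gt0].
by rewrite ltr_pM2l // ltf_pV2 ?posrE // ltr_nat.
Qed.

Definition pairing (i : I) (x : V) : R := \sum_j cartan i j * x j.

Definition refl (i : I) (x : V) : V :=
  [ffun k => x k - (k == i)%:R * pairing i x].

Definition simple_root (i : I) : V := [ffun k => (k == i)%:R].

Definition word_act (b : seq I) (x : V) : V := foldr refl x b.

Lemma sum_pick (F : I -> R) (j : I) : \sum_k (k == j)%:R * F k = F j.
Proof.
rewrite (bigD1 j) //= eqxx mul1r big1 ?addr0 // => k /negPf ->.
by rewrite mul0r.
Qed.

Lemma pairing_simple i j : pairing i (simple_root j) = cartan i j.
Proof.
rewrite /pairing -[RHS](sum_pick (cartan i) j).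
by apply: eq_bigr => k _; rewrite ffunE mulrC.
Qed.

Lemma pairing_refl i j x :
  pairing i (refl j x) = pairing i x - cartan i j * pairing j x.
Proof.
rewrite /pairing -[X in _ - cartan i j * X]/(pairing j x).
transitivity (\sum_k (cartan i k * x k - (k == j)%:R * (cartan i k * pairing j x))).
  by apply: eq_bigr => k _; rewrite ffunE; ring.
by rewrite sumrB sum_pick.
Qed.

Lemma reflK i : involutive (refl i).
Proof.
move=> x; apply/ffunP => k; rewrite ffunE pairing_refl ffunE cartan_diag.
by ring.
Qed.

Lemma word_act_cat b c x : word_act (b ++ c) x = word_act b (word_act c x).
Proof. by rewrite /word_act foldr_cat. Qed.

(* Values of the pairings with [i] and [j] along the orbit of [x] under the
   rotation [s_i s_j], interleaved as (- e 0, e 1), (- e 2, e 3), ... *)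
Fixpoint rotation_seq (K a b : R) (k : nat) : R :=
  if k is k1.+1 then
    if k1 is k2.+1 then K * rotation_seq K a b k1 - rotation_seq K a b k2 else b
  else - a.

Lemma rotation_act i j (x : V) (n : nat) : i != j ->
  let e := rotation_seq (- cartan i j) (pairing i x) (pairing j x) in
  let y := word_act (flatten (nseq n [:: i; j])) x in
  [/\ pairing i y = - e (2 * n)%N, pairing j y = e (2 * n).+1 &
      y = [ffun k => x k - (k == j)%:R * \sum_(l < n) e (2 * l).+1
                        - (k == i)%:R * \sum_(l < n) e (2 * l).+2]].
Proof.
move=> ij e y; rewrite {}/y.
have es k : e k.+2 = - cartan i j * e k.+1 - e k by [].
have comm : forall n0, flatten (nseq n0.+1 [:: i; j]) =
    flatten (nseq n0 [:: i; j]) ++ [:: i; j].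
  by elim=> //= n0 {1}->.
elim: n => [|n [IH1 IH2 IH3]].
  split; rewrite /= ?opprK //; apply/ffunP => k.
  by rewrite ffunE !big_ord0 !mulr0 !subr0.
have E : word_act (flatten (nseq n.+1 [:: i; j])) x =
    refl i (refl j (word_act (flatten (nseq n [:: i; j])) x)) by [].
rewrite {}E.
set y := word_act _ x in IH1 IH2 IH3 *.
have P1 : pairing i (refl j y) = e (2 * n).+2.
  by rewrite pairing_refl IH1 IH2 es; ring.
have P2 : pairing j (refl j y) = - e (2 * n).+1.
  by rewrite pairing_refl IH2 cartan_diag; ring.
have -> : (2 * n.+1 = (2 * n).+2)%N by lia.
split.
- by rewrite pairing_refl P1 cartan_diag; ring.
- by rewrite pairing_refl P1 P2 (cartan_sym j i) (es (2 * n).+1); ring.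
apply/ffunP => k; rewrite ffunE P1 ffunE IH2 IH3 !ffunE !big_ord_recr /=.
by ring.
Qed.

(** After [m i j] rotations the displacement of [x] along either simple root is a sum over a full
    period of the rotation sequence, which vanishes by [sin_rec_sum0]. *)
Lemma braid_act i j x :
  word_act (flatten (nseq (m i j) [:: i; j])) x = x.
Proof.
have [->|ij] := eqVneq i j; first by rewrite m_diag /= reflK.
have [->|m0] := eqVneq (m i j) 0%N; first by [].
have m1 := m_gt1 ij m0.
have [_ _ ->] := rotation_act x (m i j) ij.
set e := rotation_seq _ _ _.
have es k : e k.+2 = 2 * cos (pi / (m i j)%:R) * e k.+1 - e k.
  have -> : 2 * cos (pi / (m i j)%:R) = - cartan i j.
    by rewrite /cartan (negPf ij) (negPf m0) opprK.
  by [].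
have -> : \sum_(l < m i j) e (2 * l).+1 = 0.
  by apply: (sin_rec_sum0 m1 (e := fun k => e k.+1)) => k; rewrite es.
have -> : \sum_(l < m i j) e (2 * l).+2 = 0.
  by apply: (sin_rec_sum0 m1 (e := fun k => e k.+2)) => k; rewrite es.
by apply/ffunP => k; rewrite ffunE !mulr0 !subr0.
Qed.

Lemma word_act_equiv b c : coxeter_equiv m b c -> word_act b =1 word_act c.
Proof.
elim=> [//|a d _ IH x|a d e _ IH1 _ IH2 x|i j a d x]; first by rewrite IH.
  by rewrite IH1 IH2.
by rewrite !word_act_cat braid_act.
Qed.


(** * Length and reduced words *)

Lemma wprod_cat b c : wp (b ++ c) = (wp b * wp c)%g.
Proof. by rewrite /wprod big_cat. Qed.

Lemma wprod_nil : wp [::] = 1%g.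
Proof. by rewrite /wprod big_nil. Qed.

Lemma wprod_cons i b : wp (i :: b) = (s i * wp b)%g.
Proof. by rewrite /wprod big_cons. Qed.

Lemma wprod_seq1 i : wp [:: i] = s i.
Proof. by rewrite wprod_cons wprod_nil mulg1. Qed.

Lemma wprod_equiv b c : wp b = wp c <-> coxeter_equiv m b c.
Proof. by have [_ _] := hW; apply. Qed.

Lemma wprod_braid i j : wp (flatten (nseq (m i j) [:: i; j])) = 1%g.
Proof.
rewrite -wprod_nil; apply/wprod_equiv.
by have := coxeter_equiv_rel m i j [::] [::]; rewrite /= cats0.
Qed.

Lemma simpleK i : (s i * s i = 1)%g.
Proof.
have := wprod_braid i i.
by rewrite m_diag /= !wprod_cons wprod_nil mulg1.
Qed.

Lemma simpleV i : (s i)^-1%g = s i.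
Proof. by apply: (mulgI (s i)); rewrite mulgV simpleK. Qed.

Lemma simple_mulK i w : (s i * (s i * w) = w)%g.
Proof. by rewrite mulgA simpleK mul1g. Qed.

Lemma simple_mulKr i w : (w * s i * s i = w)%g.
Proof. by rewrite -mulgA simpleK mulg1. Qed.

Lemma wprod_rev b : wp (rev b) = (wp b)^-1%g.
Proof.
elim: b => [|i b IH]; first by rewrite wprod_nil invg1.
by rewrite rev_cons -cats1 wprod_cat IH wprod_seq1 wprod_cons invMg simpleV.
Qed.

Definition word_of (w : W) : seq I := xget [::] [set b | reduced_word s w b]%classic.

Definition len (w : W) : nat := size (word_of w).

Lemma word_ofP w : reduced_word s w (word_of w).
Proof.
have [_ hs _] := hW; have [b0 hb0] := hs w.
rewrite /word_of; case: xgetP => [b _ //|none]; exfalso.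
have [n] := ubnP (size b0); elim: n b0 hb0 => // n IH b hb hn.
case: (none b); split=> // c hc; rewrite leqNgt; apply/negP => lt.
by apply: (IH c hc); lia.
Qed.

Lemma wprod_word_of w : wp (word_of w) = w.
Proof. by case: (word_ofP w). Qed.

Lemma len_wprod_le b : (len (wp b) <= size b)%N.
Proof. by case: (word_ofP (wp b)) => _; apply. Qed.

Lemma reduced_wordP w b : reduced_word s w b <-> wp b = w /\ size b = len w.
Proof.
split=> -[hb hs]; split=> //.
  apply/eqP; rewrite eqn_leq -[in (_ <= size _)%N]hb len_wprod_le andbT.
  by apply: hs; apply: wprod_word_of.
by move=> c hc; rewrite hs -hc len_wprod_le.
Qed.

Lemma len1 : len 1%g = 0%N.
Proof. by apply/eqP; rewrite -leqn0 -wprod_nil; apply: len_wprod_le. Qed.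

Lemma len_eq0 w : len w = 0%N -> w = 1%g.
Proof. by move=> /size0nil h; rewrite -(wprod_word_of w) h wprod_nil. Qed.

Lemma lenM x y : (len (x * y)%g <= len x + len y)%N.
Proof.
rewrite -{1}(wprod_word_of x) -{1}(wprod_word_of y) -wprod_cat.
by apply: leq_trans (len_wprod_le _) _; rewrite size_cat.
Qed.

Lemma lenV x : len x^-1%g = len x.
Proof.
suff le y : (len y^-1%g <= len y)%N.
  by apply/eqP; rewrite eqn_leq le -{1}(invgK x) le.
by rewrite -{1}(wprod_word_of y) -wprod_rev (leq_trans (len_wprod_le _)) ?size_rev.
Qed.

Lemma len_simple i : (len (s i) <= 1)%N.
Proof. by rewrite -wprod_seq1 len_wprod_le. Qed.

(** Every defining relation has even length. This parity is what makes a simple reflection change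
    the length by exactly one. *)
Lemma equiv_odd b c : coxeter_equiv m b c -> odd (size b) = odd (size c).
Proof.
elim=> // [a d e _ -> _ -> //|i j a d]; rewrite !size_cat.
suff -> : size (flatten (nseq (m i j) [:: i; j])) = (2 * m i j)%N.
  by rewrite mul2n !oddD odd_double.
by elim: (m i j) => //= n ->; lia.
Qed.

Lemma len_odd b : odd (len (wp b)) = odd (size b).
Proof. by apply/equiv_odd/wprod_equiv/wprod_word_of. Qed.

Lemma len_mulr_odd w i : odd (len (w * s i)%g) = ~~ odd (len w).
Proof.
rewrite -{1}(wprod_word_of w) -wprod_seq1 -wprod_cat len_odd size_cat addn1.
by [].
Qed.

Lemma len_mulr w i : len (w * s i)%g = (len w).+1 \/ len w = (len (w * s i)%g).+1.
Proof.
have := len_mulr_odd w i; have := lenM w (s i); have := lenM (w * s i)%g (s i).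
by rewrite simple_mulKr; have := len_simple i; lia.
Qed.

Lemma len_mull w i : len (s i * w)%g = (len w).+1 \/ len w = (len (s i * w)%g).+1.
Proof. by have := len_mulr w^-1%g i; rewrite -{1 2}(simpleV i) -invMg !lenV. Qed.

Lemma len_prefix b c : size (b ++ c) = len (wp (b ++ c)) -> size b = len (wp b).
Proof.
rewrite wprod_cat size_cat => h.
have := lenM (wp b) (wp c); have := len_wprod_le b; have := len_wprod_le c; lia.
Qed.

Lemma len_suffix b c : size (b ++ c) = len (wp (b ++ c)) -> size c = len (wp c).
Proof.
rewrite wprod_cat size_cat => h.
have := lenM (wp b) (wp c); have := len_wprod_le b; have := len_wprod_le c; lia.
Qed.

(** * Action of the group on the root space, and positivity *)

Definition rho (w : W) (x : V) : V := word_act (word_of w) x.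

Lemma rho_wprod b x : rho (wp b) x = word_act b x.
Proof. by apply: word_act_equiv; apply/wprod_equiv/wprod_word_of. Qed.

Lemma rho1 x : rho 1%g x = x.
Proof. by rewrite -wprod_nil rho_wprod. Qed.

Lemma rhoM u w x : rho (u * w)%g x = rho u (rho w x).
Proof.
rewrite -{1}(wprod_word_of u) -{1}(wprod_word_of w) -wprod_cat rho_wprod.
by rewrite word_act_cat.
Qed.

Lemma rhoK w x : rho w^-1%g (rho w x) = x.
Proof. by rewrite -rhoM mulVg rho1. Qed.

Lemma rhoKV w x : rho w (rho w^-1%g x) = x.
Proof. by rewrite -rhoM mulgV rho1. Qed.

Lemma rho_simple i x : rho (s i) x = refl i x.
Proof. by rewrite -wprod_seq1 rho_wprod. Qed.

Lemma refl_lin i (c : I -> R) (y : I -> V) :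
  refl i [ffun k => \sum_j c j * y j k] = [ffun k => \sum_j c j * refl i (y j) k].
Proof.
apply/ffunP => k; rewrite !ffunE.
have -> : pairing i [ffun k => \sum_j c j * y j k] = \sum_j c j * pairing i (y j).
  rewrite /pairing.
  transitivity (\sum_l \sum_j cartan i l * (c j * y j l)).
    by apply: eq_bigr => l _; rewrite ffunE big_distrr.
  rewrite exchange_big; apply: eq_bigr => j _ /=; rewrite big_distrr /=.
  by apply: eq_bigr => l _ /=; ring.
rewrite big_distrr -sumrB; apply: eq_bigr => j _ /=; rewrite /refl ffunE; ring.
Qed.

Lemma simple_expand (x : V) : x = [ffun k => \sum_j x j * simple_root j k].
Proof.
apply/ffunP => k; rewrite ffunE -[LHS](sum_pick x k).
by apply: eq_bigr => j _; rewrite ffunE mulrC eq_sym.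
Qed.

Lemma rho_expand w (x : V) :
  rho w x = [ffun k => \sum_j x j * rho w (simple_root j) k].
Proof.
rewrite /rho; elim: (word_of w) => [|i b IH] /=; first exact: simple_expand.
by rewrite IH refl_lin.
Qed.

Lemma rhoE w (x : V) k : rho w x k = \sum_j x j * rho w (simple_root j) k.
Proof. by rewrite {1}rho_expand ffunE. Qed.

Definition vpos (x : V) := forall k, 0 <= x k.
Definition vneg (x : V) := forall k, x k <= 0.

Lemma rho_vpos w (x : V) : vpos x -> (forall i, x i != 0 -> vpos (rho w (simple_root i))) ->
  vpos (rho w x).
Proof.
move=> px h k; rewrite rhoE; apply: sumr_ge0 => i _.
have [->|xi] := eqVneq (x i) 0; first by rewrite mul0r.
by rewrite mulr_ge0 // h.
Qed.

Lemma rho_vneg w (x : V) : vpos x -> (forall i, x i != 0 -> vneg (rho w (simple_root i))) ->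
  vneg (rho w x).
Proof.
move=> px h k; rewrite rhoE; apply: sumr_le0 => i _.
have [->|xi] := eqVneq (x i) 0; first by rewrite mul0r.
by rewrite mulr_ge0_le0 // h.
Qed.

Lemma rho_opp w (x : V) : rho w [ffun k => - x k] = [ffun k => - rho w x k].
Proof.
apply/ffunP => k; rewrite rhoE ffunE rhoE -sumrN; apply: eq_bigr => j _.
by rewrite ffunE mulNr.
Qed.

(* The last letter is [j]. *)
Fixpoint alt_word (i j : I) (k : nat) : seq I :=
  if k is k1.+1 then (if odd k1 then i else j) :: alt_word i j k1 else [::].

Lemma size_alt_word i j k : size (alt_word i j k) = k.
Proof. by elim: k => //= k ->. Qed.

Lemma alt_word_split i j k l : exists b,
  alt_word i j (k + l) = b ++ alt_word i j l /\ size b = k.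
Proof.
elim: k => [|k [b [IH1 IH2]]]; first by exists [::].
by rewrite addSn /=; eexists (_ :: b); rewrite IH1 /= IH2.
Qed.

Lemma alt_word_rcons i j k : alt_word i j k ++ [:: i] = alt_word j i k.+1.
Proof. by elim: k => //= k {1}->; case: (odd k). Qed.

Lemma alt_word_double i j n : alt_word i j (2 * n) = flatten (nseq n [:: i; j]).
Proof.
elim: n => // n IH; have -> : (2 * n.+1 = (2 * n).+2)%N by lia.
by rewrite /= mul2n odd_double /= -mul2n IH.
Qed.

(** The alternating word of length [2 * m i j] is trivial, so its last [k] letters multiply to the
    inverse of the other [2 * m i j - k]. *)
Lemma len_alt_word i j k : (m i j <= k)%N -> m i j != 0%N ->
  (len (wp (alt_word i j k)) <= k - 2 * (k - m i j))%N \/ (2 * m i j < k)%N.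
Proof.
move=> mk m0; have [k2|] := leqP k (2 * m i j); last by right.
left; have [b [Eb sb]] := alt_word_split i j (2 * m i j - k) k.
have := wprod_braid i j; rewrite -alt_word_double.
have <- : (2 * m i j - k + k = 2 * m i j)%N by lia.
rewrite Eb wprod_cat => /eqP; rewrite -eq_invg_mul => /eqP <-.
rewrite lenV (leq_trans (len_wprod_le _)) // sb; lia.
Qed.

Lemma alt_word_act i j k : i != j ->
  word_act (alt_word i j k) (simple_root i) =
  [ffun l => (l == i)%:R * dihedral_coef (- cartan i j) (if odd k then k else k.+1)
           + (l == j)%:R * dihedral_coef (- cartan i j) (if odd k then k.+1 else k)].
Proof.
move=> ij; have ji : (j == i) = false by rewrite eq_sym (negPf ij).
have pr l p q : pairing l [ffun l => (l == i)%:R * p + (l == j)%:R * q] =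
    cartan l i * p + cartan l j * q.
  rewrite /pairing -(sum_pick (fun n => cartan l n * p)).
  rewrite -(sum_pick (fun n => cartan l n * q)) -big_split.
  by apply: eq_bigr => n _; rewrite ffunE /=; ring.
set p := dihedral_coef _.
have pS n : p n.+2 = - cartan i j * p n.+1 - p n by [].
have [p0 p1] : p 0%N = 0 /\ p 1%N = 1 by [].
elim: k => [|k IH] /=.
  by apply/ffunP => l; rewrite !ffunE p0 p1 mulr1 mulr0 addr0.
rewrite IH; case: (odd k) => /=; apply/ffunP => l;
  rewrite [LHS]ffunE pr !ffunE !cartan_diag ?(cartan_sym j i) ?pS; ring.
Qed.

(* [lia] up to convertible presentations of the group law inside [len]. *)
Local Ltac len_lia :=
  repeat match goal with H : ?P |- _ =>
    lazymatch P with
    | forall _, _ => fail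
    | context [len _] => move: H
    end
  end;
  repeat (move: (len _) => ?); lia.

Lemma simple_root_pos i : vpos (simple_root i).
Proof. by move=> k; rewrite ffunE ler0n. Qed.

Lemma dihedral_coef_cartan_ge0 i j k : i != j -> (m i j = 0%N \/ (k <= m i j)%N) ->
  0 <= dihedral_coef (- cartan i j) k.
Proof.
move=> ij; rewrite /cartan (negPf ij).
case: eqP => [_ _|/eqP m0]; first by rewrite opprK dihedral_coef_ge0_inf.
case=> [h|km]; first by rewrite h in m0.
by rewrite opprK dihedral_coef_ge0 // m_gt1.
Qed.

Lemma alt_word_act_pos i j v k : i != j ->
  len (v * wp (alt_word i j k))%g = (len v + k)%N ->
  (len (v * wp (alt_word i j k)) < len (v * wp (alt_word i j k) * s i))%N ->
  vpos (rho v (simple_root i)) -> vpos (rho v (simple_root j)) ->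
  vpos (rho (v * wp (alt_word i j k)) (simple_root i)).
Proof.
move=> ij hl hlt pi pj.
(* Otherwise the last [m i j + 1] letters of [alt_word j i k.+1] could be replaced by at most
   [m i j - 1], and appending [i] would not lengthen the element. *)
have hk : m i j = 0%N \/ (k.+1 <= m i j)%N.
  have [|m0] := eqVneq (m i j) 0%N; first by left.
  right; rewrite ltnNge; apply/negP => mk; move: hlt; rewrite hl.
  rewrite -mulgA -wprod_seq1 -wprod_cat alt_word_rcons.
  have m1 := m_gt1 ij m0.
  have [b [Eb sb]] := alt_word_split j i (k - m i j) (m i j).+1.
  have -> : k.+1 = (k - m i j + (m i j).+1)%N by lia.
  rewrite Eb wprod_cat.
  have := @len_alt_word j i (m i j).+1; rewrite m_sym => h.
  have := lenM v (wp b * wp (alt_word j i (m i j).+1))%g.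
  have := lenM (wp b) (wp (alt_word j i (m i j).+1)); have := len_wprod_le b.
  have {h} := h (leqnSn _) m0.
  by case; len_lia.
rewrite rhoM rho_wprod alt_word_act //; apply: rho_vpos => [l|l].
  rewrite ffunE addr_ge0 // mulr_ge0 ?ler0n //;
    by apply: dihedral_coef_cartan_ge0 => //; case: hk => hk; [left|right; case: ifP; lia].
rewrite ffunE; have [->//|_] := eqVneq l i; have [->//|_] := eqVneq l j.
by rewrite !mul0r addr0 eqxx.
Qed.

(* Factor [w = v y] with [y] a longest alternating suffix in [i] and [j] of a
   reduced word of [w]; then [v] shortens under neither letter, and [y] moves
   [simple_root i] inside the positive cone of [simple_root i, simple_root j]. *)
Theorem rho_simple_pos w i :
  (len w < len (w * s i)%g)%N -> vpos (rho w (simple_root i)).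
Proof.
have [n] := ubnP (len w); elim: n w i => // n IH w i wn hlt.
have [b0 hb0 sb0] : exists2 b, wp b = w & size b = len w.
  by exists (word_of w) => //; apply: wprod_word_of.
case: (lastP b0) hb0 sb0 => [|b j] hb sb.
  by rewrite -hb wprod_nil rho1; apply: simple_root_pos.
have Eb : w = (wp b * s j)%g by rewrite -hb -cats1 wprod_cat wprod_seq1.
have lb : len w = (len (wp b) + 1)%N.
  by move: sb; rewrite -hb -cats1 => sb; rewrite -sb size_cat -(len_prefix sb).
have ij : i != j.
  by apply: contraTneq hlt => ij; rewrite -leqNgt {1}Eb ij simple_mulKr lb leq_addr.
suff inner : forall l v k, (len v < l)%N -> (0 < k)%N ->
    w = (v * wp (alt_word i j k))%g -> len w = (len v + k)%N ->
    vpos (rho w (simple_root i)).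
  apply: (inner (len (wp b)).+1 (wp b) 1%N) => //.
  by rewrite /= wprod_seq1.
elim=> // l IHl v k vl k0 Ew lw.
set f := if odd k then i else j.
have [lvf|lvf] := len_mulr v f; last first.
  apply: (IHl (v * s f)%g k.+1); [len_lia|by []| |len_lia].
  by rewrite /= wprod_cons !mulgA simple_mulKr.
(* This letter is the first of [alt_word i j k]; if [v] shortened under it, [w] would be shorter
   than [len v + k]. *)
have lvg : len (v * s (if odd k then j else i))%g = (len v).+1.
  have [//|h] := len_mulr v (if odd k then j else i).
  case: k k0 Ew lw {f lvf} h => // k _ Ew lw /= h.
  have h' : len v = (len (v * s (if odd k then i else j))%g).+1.
    by move: h; case: (odd k).
  have := lenM (v * s (if odd k then i else j))%g (wp (alt_word i j k)).
  have := len_wprod_le (alt_word i j k); rewrite size_alt_word.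
  by move: lw; rewrite Ew /= wprod_cons !mulgA; len_lia.
have [lvi lvj] : (len v < len (v * s i)%g)%N /\ (len v < len (v * s j)%g)%N.
  by move: lvf lvg; rewrite /f; case: (odd k) => /= -> ->.
rewrite Ew; apply: alt_word_act_pos; rewrite -?Ew //.
  by apply: IH => //; len_lia.
by apply: IH => //; len_lia.
Qed.

(** * Invariant form and roots *)

Definition bilinear (x y : V) : R := \sum_i x i * pairing i y.

Lemma bilinear_sym x y : bilinear x y = bilinear y x.
Proof.
rewrite /bilinear /pairing.
transitivity (\sum_i \sum_j x i * (cartan i j * y j)).
  by apply: eq_bigr => i _; rewrite big_distrr.
rewrite exchange_big; apply: eq_bigr => j _ /=; rewrite big_distrr.
by apply: eq_bigr => i _ /=; rewrite cartan_sym; ring.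
Qed.

Lemma bilinear_simple i y : bilinear (simple_root i) y = pairing i y.
Proof.
rewrite /bilinear -[RHS](sum_pick (fun k => pairing k y)).
by apply: eq_bigr => k _; rewrite ffunE.
Qed.

Lemma bilinear_refl_l i x y :
  bilinear (refl i x) y = bilinear x y - pairing i x * pairing i y.
Proof.
rewrite /bilinear.
transitivity (\sum_k (x k * pairing k y - (k == i)%:R * (pairing i x * pairing k y))).
  by apply: eq_bigr => k _; rewrite ffunE; ring.
by rewrite sumrB sum_pick.
Qed.

Lemma bilinear_refl i x y : bilinear (refl i x) (refl i y) = bilinear x y.
Proof.
rewrite bilinear_refl_l bilinear_sym bilinear_refl_l bilinear_sym pairing_refl.
by rewrite cartan_diag; ring.
Qed.

Lemma bilinear_rho w x y : bilinear (rho w x) (rho w y) = bilinear x y.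
Proof.
rewrite /rho; elim: (word_of w) => //= i b IH.
by rewrite bilinear_refl.
Qed.

Definition isroot (x : V) := exists w i, x = rho w (simple_root i).

Lemma isroot_simple i : isroot (simple_root i).
Proof. by exists 1%g, i; rewrite rho1. Qed.

Lemma isroot_rho w x : isroot x -> isroot (rho w x).
Proof. by case=> u [i ->]; exists (w * u)%g, i; rewrite rhoM. Qed.

Lemma isroot_refl i x : isroot x -> isroot (refl i x).
Proof. by rewrite -rho_simple; apply: isroot_rho. Qed.

Lemma refl_simple i : refl i (simple_root i) = [ffun k => - simple_root i k].
Proof.
apply/ffunP => k; rewrite [LHS]ffunE pairing_simple cartan_diag !ffunE; ring.
Qed.

Lemma root_sign x : isroot x -> vpos x \/ vneg x.
Proof.
case=> w [i ->]; have [h|h] := len_mulr w i.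
  by left; apply: rho_simple_pos; rewrite h.
right => k.
have : vpos (rho (w * s i)%g (simple_root i)).
  by apply: rho_simple_pos; rewrite simple_mulKr h.
move/(_ k); rewrite rhoM rho_simple refl_simple rho_opp ffunE oppr_ge0.
by [].
Qed.

Lemma root_norm x : isroot x -> bilinear x x = 2.
Proof.
by case=> w [i ->]; rewrite bilinear_rho bilinear_simple pairing_simple cartan_diag.
Qed.

Lemma root_pos_neg x : isroot x -> vpos x -> vneg x -> False.
Proof.
move=> /root_norm h p n; suff : bilinear x x = 0 by rewrite h => /eqP; rewrite pnatr_eq0.
rewrite /bilinear big1 // => i _.
by have -> : x i = 0; [apply/eqP; rewrite eq_le p n | rewrite mul0r].
Qed.

(** Only coordinate [i] changes, so a change of sign forces [x] to be a multiple of [simple_root i];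
    norm 2 and positivity make the factor 1. *)
Lemma refl_pos i x : isroot x -> vpos x -> x != simple_root i -> vpos (refl i x).
Proof.
move=> rx px xi; have [//|n] := root_sign (isroot_refl i rx).
exfalso; move/eqP: xi; apply.
have x0 k : k != i -> x k = 0.
  move=> ki; apply/eqP; rewrite eq_le px andbT.
  by have := n k; rewrite ffunE (negPf ki) mul0r subr0.
have E : x = [ffun k => x i * simple_root i k].
  apply/ffunP => k; rewrite !ffunE.
  by have [->|/x0 ->] := eqVneq k i; rewrite ?mulr1 ?mulr0.
have := root_norm rx; rewrite /bilinear (bigD1 i) //= big1 ?addr0; last first.
  by move=> k /x0 ->; rewrite mul0r.
have -> : pairing i x = 2 * x i.
  rewrite /pairing (bigD1 i) //= cartan_diag big1 ?addr0 // => k /x0 ->.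
  by rewrite mulr0.
move=> h; have /eqP : (x i - 1) * (x i + 1) = 0.
  by have -> : (x i - 1) * (x i + 1) = (x i * (2 * x i) - 2) / 2; [field | rewrite h subrr mul0r].
rewrite mulf_eq0 subr_eq0 => /orP[/eqP e|/eqP e].
  by rewrite E; apply/ffunP => k; rewrite ffunE e mul1r.
by exfalso; have := px i; lra.
Qed.

(** * Left descents *)

Definition ldesc (i : I) (w : W) : bool := (len (s i * w)%g < len w)%N.

Lemma ldesc_simple_mul i w : ldesc i (s i * w)%g = ~~ ldesc i w.
Proof. by rewrite /ldesc simple_mulK; have := len_mull w i; len_lia. Qed.

Lemma rho_simple_mulV i w x : rho (s i * w)^-1%g x = rho w^-1%g (refl i x).
Proof. by rewrite invMg simpleV rhoM rho_simple. Qed.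

Lemma ldescN_pos i w : ~~ ldesc i w -> vpos (rho w^-1%g (simple_root i)).
Proof.
move=> h; apply: rho_simple_pos; rewrite -(simpleV i) -invMg !lenV.
by move: h; rewrite /ldesc; have := len_mull w i; len_lia.
Qed.

Lemma ldesc_neg i w : ldesc i w -> vneg (rho w^-1%g (simple_root i)).
Proof.
rewrite -{1}[w](simple_mulK i) ldesc_simple_mul => /ldescN_pos h k.
by move: (h k); rewrite rho_simple_mulV refl_simple rho_opp ffunE oppr_ge0.
Qed.

Lemma ldescP i w : ldesc i w <-> vneg (rho w^-1%g (simple_root i)).
Proof.
split=> [|h]; first exact: ldesc_neg.
apply: contraT => /ldescN_pos p; exfalso; apply: root_pos_neg p h.
exact/isroot_rho/isroot_simple.
Qed.

Lemma ldescN_simple i : ~~ ldesc i 1%g.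
Proof. by rewrite /ldesc len1 ltn0. Qed.

Lemma ldesc_simple i : ldesc i (s i).
Proof. by rewrite -[s i]mulg1 ldesc_simple_mul ldescN_simple. Qed.

Lemma len_ldesc i w : ldesc i w -> len w = (len (s i * w)%g).+1.
Proof. by rewrite /ldesc; have := len_mull w i; len_lia. Qed.

Lemma len_ldescN i w : ~~ ldesc i w -> len (s i * w)%g = (len w).+1.
Proof. by rewrite /ldesc; have := len_mull w i; len_lia. Qed.

Lemma ldesc_wprod i b : size (i :: b) = len (wp (i :: b)) -> ldesc i (wp (i :: b)).
Proof.
by move=> h; rewrite /ldesc -h wprod_cons simple_mulK /= ltnS len_wprod_le.
Qed.

Lemma ex_ldesc w : w != 1%g -> exists i, ldesc i w.
Proof.
have := wprod_word_of w; have : size (word_of w) = len w by [].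
case: (word_of w) => [|i b] sb hb; first by rewrite -hb wprod_nil eqxx.
by move=> _; exists i; rewrite -hb; apply: ldesc_wprod; rewrite hb.
Qed.

Lemma ldesc_ind (P : W -> Prop) : P 1%g ->
  (forall i w, ~~ ldesc i w -> P w -> P (s i * w)%g) -> forall w, P w.
Proof.
move=> P1 PS w; have [n] := ubnP (len w); elim: n w => // n IH w wn.
have [->//|/ex_ldesc[i di]] := eqVneq w 1%g.
rewrite -(simple_mulK i w); apply: PS; first by rewrite ldesc_simple_mul di.
by apply: IH; have := len_ldesc di; len_lia.
Qed.

(** * Weak order and inversions *)

(** Inclusion of inversion sets, an inversion of [u] being a positive root that [u^-1] makes
    negative. [weak_leP] identifies this order with the one given by prefixes of reduced words. *)
Definition wle (u v : W) : Prop := forall x, isroot x -> vpos x ->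
  vneg (rho u^-1%g x) -> vneg (rho v^-1%g x).

Lemma wle_refl u : wle u u. Proof. by []. Qed.

Lemma wle_trans v u w : wle u v -> wle v w -> wle u w.
Proof. by move=> h1 h2 x rx px n; apply: h2 => //; apply: h1. Qed.

Lemma wle1 v : wle 1%g v.
Proof. by move=> x rx px; rewrite invg1 rho1 => n; case: (root_pos_neg rx px n). Qed.

Lemma wle_ldesc i u v : wle u v -> ldesc i u -> ldesc i v.
Proof.
move=> h /ldescP n; apply/ldescP/h => //; first exact: isroot_simple.
exact: simple_root_pos.
Qed.

Lemma wle_simple_mul i u v : ~~ ldesc i v -> wle u v -> wle (s i * u)%g (s i * v)%g.
Proof.
move=> dv h x rx px; rewrite !rho_simple_mulV => n.
have [->|xi] := eqVneq x (simple_root i).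
  move=> k; have := ldescN_pos dv k.
  by rewrite refl_simple rho_opp ffunE oppr_le0.
by apply: h => //; [apply: isroot_refl | apply: refl_pos].
Qed.

Lemma wle_simple_mulI i u v : ~~ ldesc i u -> wle (s i * u)%g (s i * v)%g -> wle u v.
Proof.
move=> du h x rx px n.
have xi : x != simple_root i.
  by apply: contraNneq du => xi; apply/ldescP; rewrite -xi.
have := h (refl i x); rewrite !rho_simple_mulV reflK; apply=> //.
  exact: isroot_refl.
exact: refl_pos.
Qed.

Lemma wle_simpleE i u v : ~~ ldesc i u -> ~~ ldesc i v ->
  wle u v <-> wle (s i * u)%g (s i * v)%g.
Proof.
by move=> du dv; split; [apply: wle_simple_mul | apply: wle_simple_mulI].
Qed.

Lemma wle_simple i w : wle (s i) w <-> ldesc i w.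
Proof.
split=> [h|d]; first by apply: wle_ldesc h (ldesc_simple i).
rewrite -[s i]mulg1 -(simple_mulK i w); apply: wle_simple_mul; last exact: wle1.
by rewrite ldesc_simple_mul d.
Qed.

Lemma wle_len u v : wle u v <-> len v = (len u + len (u^-1 * v)%g)%N.
Proof.
elim/ldesc_ind: u v => [|i u du IH] v.
  by rewrite invg1 mul1g len1; split=> // _; apply: wle1.
rewrite (len_ldescN du) -{2 3}[v](simple_mulK i) invMg simpleV -!mulgA simple_mulK.
split=> [h|h].
  have dv : ldesc i v by apply: wle_ldesc h _; rewrite ldesc_simple_mul.
  rewrite (len_ldesc dv) addSn; congr _.+1; apply/IH.
  by apply: (@wle_simple_mulI i) => //; rewrite simple_mulK.
have dv : ldesc i v.
  have := lenM u (u^-1 * (s i * v))%g; rewrite mulKVg /ldesc h.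
  by len_lia.
rewrite -(simple_mulK i v); apply: wle_simple_mul.
  by rewrite ldesc_simple_mul dv.
by apply/IH; move: h; rewrite (len_ldesc dv); len_lia.
Qed.

Lemma wle_leq_len u v : wle u v -> (len u <= len v)%N.
Proof. by move/wle_len->; apply: leq_addr. Qed.

Lemma wle_len_anti u v : wle u v -> (len v <= len u)%N -> u = v.
Proof.
move/wle_len => h h2; have h0 : len (u^-1 * v)%g = 0%N by len_lia.
by apply: (mulgI u^-1%g); rewrite mulVg (len_eq0 h0).
Qed.

Lemma wle_anti u v : wle u v -> wle v u -> u = v.
Proof. by move=> h1 /wle_leq_len; apply: wle_len_anti. Qed.

Lemma weak_leP u v : weak_le s u v <-> wle u v.
Proof.
split=> [/asboolP[a [b [/reduced_wordP[ha la] /reduced_wordP[hv lv]]]]|h].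
  apply/wle_len; rewrite -hv -ha wprod_cat mulKg -wprod_cat.
  move: (lv) (lv); rewrite -hv => /len_prefix <- /len_suffix <-.
  by rewrite -size_cat lv hv.
apply/asboolP; exists (word_of u), (word_of (u^-1 * v)%g).
split; apply/reduced_wordP; first by rewrite wprod_word_of.
rewrite wprod_cat !wprod_word_of mulKVg; split=> //.
by rewrite size_cat; apply/esym/wle_len.
Qed.

(** * Standard parabolic subgroups *)

Definition in_par (K : pred I) (w : W) : Prop := exists2 b, wp b = w & all K b.

Lemma in_par1 K : in_par K 1%g.
Proof. by exists [::]; rewrite ?wprod_nil. Qed.

Lemma in_parM K u v : in_par K u -> in_par K v -> in_par K (u * v)%g.
Proof.
by move=> [a <- ha] [b <- hb]; exists (a ++ b); rewrite ?wprod_cat // all_cat ha.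
Qed.

Lemma in_parV K u : in_par K u -> in_par K u^-1%g.
Proof. by move=> [a <- ha]; exists (rev a); rewrite ?wprod_rev // all_rev. Qed.

Lemma in_par_simple (K : pred I) i : K i -> in_par K (s i).
Proof. by move=> Ki; exists [:: i]; rewrite ?wprod_seq1 //= Ki. Qed.

(** This invariance does the work of coset decompositions below: it confines the descents and the
    inversions of an element of [W_K] to [K]. *)
Lemma rho_par (K : pred I) w (x : V) k : in_par K w -> ~~ K k -> rho w x k = x k.
Proof.
move=> [b <- hb] Kk; rewrite rho_wprod; elim: b hb => //= i b IH /andP[Ki /IH h].
rewrite ffunE h; have -> : (k == i) = false by apply: contraNF Kk => /eqP ->.
by rewrite mul0r subr0.
Qed.

Lemma ldesc_par (K : pred I) w i : in_par K w -> ldesc i w -> K i.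
Proof.
move=> /in_parV pw /ldesc_neg/(_ i) n; apply: contraT => Ki; move: n.
by rewrite (rho_par _ pw Ki) ffunE eqxx lern0.
Qed.

Lemma par_inversion_supp (K : pred I) w (x : V) k : in_par K w -> vpos x ->
  vneg (rho w^-1%g x) -> ~~ K k -> x k = 0.
Proof.
move=> pw px n Kk; apply/eqP; rewrite eq_le px andbT.
by rewrite -(rho_par x (in_parV pw) Kk).
Qed.

Lemma ex_max_len (P : W -> Prop) w0 : P w0 ->
  exists2 w, P w & forall w', P w' -> (len w' <= len w)%N.
Proof.
move=> P0; have P0' : `[< P w0 >] by apply/asboolP.
case: (@arg_maxnP W w0 (fun w => `[< P w >]) len P0') => w /asboolP Pw h.
by exists w => // w' /asboolP/h.
Qed.

Lemma ex_par_longest (K : pred I) :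
  exists2 d, in_par K d & forall i, K i -> ldesc i d.
Proof.
have [d pd h] := ex_max_len (in_par1 K); exists d => // i Ki.
apply: contraT => /len_ldescN e; have := h (s i * d)%g.
by rewrite e ltnn; apply; apply: in_parM (in_par_simple Ki) pd.
Qed.

(** The inversions of [d] are nonnegative combinations of simple roots from [K], and [g^-1] makes
    each of these negative. *)
Lemma par_longest_le (K : pred I) d g :
  in_par K d -> (forall i, K i -> ldesc i g) -> wle d g.
Proof.
move=> pd h x rx px n; apply: rho_vneg => // i xi.
by apply/ldesc_neg/h; apply: contraNT xi => /(par_inversion_supp pd px n) ->.
Qed.

(* [g = x d0^-1 g0], with [d0] longest in [W_K] and [g0] longest in [W], has the
   inversions of [x] together with all the positive roots not supported on [K]. *)
Lemma par_cap_upper (K : pred I) x i : in_par K x -> ~~ K i ->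
  exists g, [/\ wle x g, ldesc i g & forall y, in_par K y -> wle y g -> wle y x].
Proof.
move=> px Ki.
have [d pd hd] := ex_par_longest K; have [g0 _ hg0] := ex_par_longest predT.
have neg0 z : isroot z -> vpos z -> vneg (rho g0^-1%g z).
  by move=> rz pz; apply: rho_vneg => // k _; apply/ldesc_neg/hg0.
have neg0' z : isroot z -> vneg z -> vpos (rho g0^-1%g z).
  move=> rz nz k; rewrite -oppr_le0.
  have : vneg (rho g0^-1%g [ffun k => - z k]).
    apply: rho_vneg => [l|l _]; first by rewrite ffunE oppr_ge0.
    exact/ldesc_neg/hg0.
  by move/(_ k); rewrite rho_opp ffunE.
have negd (z : V) : (forall k, ~~ K k -> z k = 0) -> vpos z -> vneg (rho d^-1%g z).
  move=> sz pz; apply: rho_vneg => // k zk; apply/ldesc_neg/hd.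
  by apply: contraNT zk => /sz ->.
have negd' (z : V) : (forall k, ~~ K k -> z k = 0) -> vneg z -> vpos (rho d^-1%g z).
  move=> sz nz k; rewrite -oppr_le0.
  have : vneg (rho d^-1%g [ffun k => - z k]).
    by apply: negd => l; rewrite ffunE ?oppr_ge0 // => /sz ->; rewrite oppr0.
  by move/(_ k); rewrite rho_opp ffunE.
have E z : rho (x * d * g0)^-1%g z = rho g0^-1%g (rho d^-1%g (rho x^-1%g z)).
  by rewrite !invMg !rhoM.
have supp y (z : V) k : in_par K y -> vpos z -> vneg (rho y^-1%g z) -> ~~ K k ->
    rho x^-1%g z k = 0.
  move=> py pz nz Kk; rewrite (rho_par _ (in_parV px) Kk).
  exact: par_inversion_supp py pz nz Kk.
exists (x * d * g0)%g; split.
- move=> z rz pz nz; rewrite E; apply: neg0; first by do 2!apply: isroot_rho.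
  by apply: negd' => // k; apply: supp pz nz.
- apply/ldescP; rewrite E.
  set z := rho d^-1%g _.
  have rz : isroot z by do 2!apply: isroot_rho; apply: isroot_simple.
  apply: neg0 => //; have [//|nz] := root_sign rz; exfalso.
  have := nz i; rewrite /z (rho_par _ (in_parV pd) Ki) (rho_par _ (in_parV px) Ki).
  by rewrite ffunE eqxx lern0.
- move=> y py hy z rz pz nz.
  have rz' : isroot (rho x^-1%g z) by apply: isroot_rho.
  have [pz'|//] := root_sign rz'; exfalso.
  have nd := negd _ (fun k => supp y z k py pz nz) pz'.
  apply: (root_pos_neg (x := rho (x * d * g0)^-1%g z)).
  + exact: isroot_rho.
  + by rewrite E; apply: neg0' => //; do 2!apply: isroot_rho.
  + exact: hy.
Qed.

(** * Sortable elements *)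

(* Words obtained by reading the list of letters cyclically: a letter is either
   taken, provided the result stays reduced, or discarded forever. These are the
   sorting words of the sortable elements. *)
Inductive nested_word : seq I -> seq I -> Prop :=
| nested_nil : nested_word [::] [::]
| nested_skip i a b : nested_word a b -> nested_word (i :: a) b
| nested_take i a b :
    nested_word (rcons a i) b -> ~~ ldesc i (wp b) -> nested_word (i :: a) (i :: b).

Definition srt (a : seq I) (w : W) : Prop := exists2 b, nested_word a b & wp b = w.

Lemma nested_sub a b : nested_word a b -> all (mem a) b.
Proof.
elim=> //= [i {}a {}b _ /allP h|i {}a {}b _ /allP h _].
  by apply/allP => k /h /= ka; rewrite /= in_cons ka orbT.
by rewrite mem_head /=; apply/allP => k /h /=; rewrite mem_rcons.
Qed.

Lemma nested_reduced a b : nested_word a b -> size b = len (wp b).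
Proof.
elim=> [|//|i {}a {}b _ IH d]; first by rewrite wprod_nil len1.
by rewrite wprod_cons (len_ldescN d) -IH.
Qed.

Lemma srt_par a w : srt a w -> in_par (mem a) w.
Proof. by case=> b /nested_sub h <-; exists b. Qed.

Lemma nested_word_nil a : nested_word a [::].
Proof. by elim: a => [|i a IH]; [apply: nested_nil | apply: nested_skip]. Qed.

Lemma srt1 a : srt a 1%g.
Proof. by exists [::]; [apply: nested_word_nil | rewrite wprod_nil]. Qed.

Lemma srt_skip i a w : srt a w -> srt (i :: a) w.
Proof. by case=> b h <-; exists b => //; apply: nested_skip. Qed.

Lemma srt_take i a w : srt (rcons a i) w -> ~~ ldesc i w -> srt (i :: a) (s i * w)%g.
Proof.
case=> b h <- d; exists (i :: b); last by rewrite wprod_cons.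
exact: nested_take.
Qed.

Lemma srt_simple i a : srt (i :: a) (s i).
Proof. by rewrite -[s i]mulg1; apply: srt_take (srt1 _) (ldescN_simple i). Qed.

(** A word that skips [i] never meets it again, so its product lies in a parabolic subgroup without
    [i] and cannot have [i] as a descent. *)
Lemma srt_ldesc i a w : uniq (i :: a) -> srt (i :: a) w -> ldesc i w ->
  srt (rcons a i) (s i * w)%g.
Proof.
move=> /= /andP[ia _] [b h <-]; inversion h; subst.
  move=> /(ldesc_par _)/=; have pb : in_par (mem a) (wp b) by apply: srt_par; exists b.
  by move/(_ _ pb) => /=; rewrite (negPf ia).
by move=> _; rewrite wprod_cons simple_mulK; exists b0.
Qed.

Lemma srt_ldescN i a w : srt (i :: a) w -> ~~ ldesc i w -> srt a w.
Proof.
move=> [b h <-]; inversion h; subst; first by exists b.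
by rewrite wprod_cons ldesc_simple_mul H3.
Qed.

Lemma nested_subseq a a' b : subseq a' a -> nested_word a' b -> nested_word a b.
Proof.
have [n] := ubnP (size a + (size b) * 2); elim: n a a' b => // n IH a a' b hn sub h.
case: a hn sub => [|x a] hn sub.
  by move: h; rewrite (eqP sub).
case: a' sub h => [|y a'] sub h.
  by inversion h; apply: nested_word_nil.
move: sub => /=; case: eqP => [yx|_] sub; last first.
  by apply: nested_skip; apply: (IH _ (y :: a')) => //; move: hn => /=; lia.
subst y; inversion h; subst.
  by apply: nested_skip; apply: (IH _ a') => //; move: hn => /=; lia.
apply: nested_take => //; apply: (IH _ (rcons a' x)) => //.
  by move: hn; rewrite size_rcons /=; lia.
by rewrite -!cats1 cat_subseq.
Qed.

Lemma srt_subseq a a' w : subseq a' a -> srt a' w -> srt a w.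
Proof. by move=> sub [b h <-]; exists b => //; apply: nested_subseq h. Qed.

Lemma nested_del i a b : nested_word a b -> i \notin b ->
  nested_word [seq k <- a | k != i] b.
Proof.
elim=> [|k {}a {}b _ IH ib|k {}a {}b _ IH d] /=; first by move=> _; apply: nested_nil.
  by case: eqP => _ /=; [apply: IH | apply/nested_skip/IH].
rewrite in_cons negb_or eq_sym => /andP[ki ib]; rewrite ki.
by apply: nested_take => //; move: (IH ib); rewrite filter_rcons /= ki.
Qed.

(** Since [r] does not recur, it can be discarded where it was taken. The letters before it stay
    allowed: by commutation the shortened suffix is a prefix, in the weak order, of the original
    one, so it has no new descents. *)
Lemma nested_remove a b b1 r b2 : uniq a -> nested_word a b -> b = b1 ++ r :: b2 ->
  r \notin b2 -> commute (s r) (wp b2) -> nested_word a (b1 ++ b2).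
Proof.
move=> ua h; elim: h ua b1 => [|i {}a {}b _ IH|i {}a {}b h IH d] ua b1 E rb cr.
- by case: b1 E.
- by apply: nested_skip; apply: IH => //; case/andP: ua.
case: b1 E => [[ei eb]|x b1 [ei eb]] /=.
  subst; apply: nested_skip; case/andP: ua => ra ua.
  have := nested_del h rb; rewrite filter_rcons /= eqxx /=.
  rewrite (_ : [seq k <- a | k != r] = a) //; apply/all_filterP/allP => k ka /=.
  by apply: contraNneq ra => <-.
rewrite -ei; apply: nested_take.
  by apply: IH => //; rewrite rcons_uniq.
have E : wp b = (wp (b1 ++ b2) * s r)%g.
  by rewrite eb !wprod_cat wprod_cons cr mulgA.
apply: contra d; apply: wle_ldesc; apply/wle_len.
have := nested_reduced h; rewrite {1}eb size_cat /= => sb.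
rewrite E mulKg; have := len_simple r; have := lenM (wp (b1 ++ b2)) (s r).
have := len_wprod_le (b1 ++ b2); rewrite size_cat -E -sb; len_lia.
Qed.


(* [omega a] is the skew form of the Coxeter element with word [a]: it is
   [- cartan i j] on simple roots with [i] before [j] in [a]. *)
Fixpoint euler (a : seq I) (x y : V) : R :=
  if a is i :: a' then x i * (\sum_(j <- a') cartan i j * y j) + euler a' x y else 0.

Definition omega (a : seq I) (x y : V) : R := euler a y x - euler a x y.

Lemma euler_rcons a i x y :
  euler (rcons a i) x y = euler a x y + (\sum_(j <- a) cartan i j * x j) * y i.
Proof.
elim: a => [|k a IH] /=; first by rewrite !big_nil mul0r mulr0.
by rewrite IH big_rcons big_cons /= (cartan_sym k i); ring.
Qed.

Lemma eq_euler a (x x' y y' : V) : {in a, x =1 x'} -> {in a, y =1 y'} ->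
  euler a x y = euler a x' y'.
Proof.
elim: a => //= k a IH hx hy; rewrite hx ?mem_head // IH; last first.
- by move=> l la; rewrite hy // in_cons la orbT.
- by move=> l la; rewrite hx // in_cons la orbT.
congr (_ * _ + _); apply: eq_big_seq => l la.
by rewrite hy // in_cons la orbT.
Qed.

Lemma euler0l a (x y : V) : (forall k, k \in a -> x k = 0) -> euler a x y = 0.
Proof.
elim: a => //= k a IH h; rewrite h ?mem_head // mul0r add0r IH // => l la.
by apply: h; rewrite in_cons la orbT.
Qed.

Lemma euler0r a (x y : V) : (forall k, k \in a -> y k = 0) -> euler a x y = 0.
Proof.
elim: a => //= k a IH h; have h' l : l \in a -> y l = 0.
  by move=> la; apply: h; rewrite in_cons la orbT.
by rewrite big_seq big1 ?mulr0 ?add0r ?IH // => l /h' ->; rewrite mulr0.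
Qed.

Lemma pairing_supp i a (x : V) : uniq (i :: a) -> (forall k, k \notin i :: a -> x k = 0) ->
  pairing i x = 2 * x i + \sum_(j <- a) cartan i j * x j.
Proof.
move=> ua h; rewrite -{1}(cartan_diag i) -(big_cons _ _ _ _ xpredT (fun j => cartan i j * x j)).
rewrite big_uniq //= /pairing [LHS](bigID (mem (i :: a))) /= [X in _ + X]big1 ?addr0 //.
by move=> k /h ->; rewrite mulr0.
Qed.

(** Conjugating the Coxeter element by its first letter moves that letter to the end; the skew form
    follows, so it is adapted to the rotation in [nested_take]. *)
Lemma omega_refl i a (x y : V) : uniq (i :: a) ->
  (forall k, k \notin i :: a -> x k = 0) -> (forall k, k \notin i :: a -> y k = 0) ->
  omega (i :: a) (refl i x) (refl i y) = omega (rcons a i) x y.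
Proof.
move=> ua hx hy; rewrite /omega !euler_rcons /=.
have off z : {in a, refl i z =1 z}.
  move=> k ka; rewrite ffunE; have -> : (k == i) = false; last by rewrite mul0r subr0.
  by apply: contraTF ka => /eqP ->; case/andP: ua.
have sm z : \sum_(j <- a) cartan i j * refl i z j = \sum_(j <- a) cartan i j * z j.
  by apply: eq_big_seq => k /off ->.
rewrite !(eq_euler (off _) (off _)) !sm.
have dg z : refl i z i = z i - pairing i z by rewrite ffunE eqxx mul1r.
by rewrite !dg (pairing_supp ua hx) (pairing_supp ua hy); ring.
Qed.

Lemma reduced_root_pos b j c : size (b ++ j :: c) = len (wp (b ++ j :: c)) ->
  vpos (rho (wp b) (simple_root j)).
Proof.
rewrite -cat_rcons => /len_prefix h; apply: rho_simple_pos.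
rewrite -wprod_seq1 -wprod_cat cats1 -h size_rcons ltnS.
exact: len_wprod_le.
Qed.

Lemma rho_word_supp (K : pred I) b j k : all K b -> K j -> ~~ K k ->
  rho (wp b) (simple_root j) k = 0.
Proof.
move=> hb Kj Kk; rewrite (rho_par (K := K)) //; last by exists b.
by rewrite ffunE; case: eqP Kk => // ->; rewrite Kj.
Qed.

(** Rotation reduces to the case where [i] is the first letter. Its root is then simple, and [omega]
    against a positive root [y] is minus the sum of [cartan i l * y l] over later letters [l], all
    of whose terms are nonpositive. *)
Lemma nested_omega a b b1 i b2 j b3 : uniq a -> nested_word a b ->
  b = b1 ++ i :: b2 ++ j :: b3 ->
  0 <= omega a (rho (wp b1) (simple_root i)) (rho (wp (b1 ++ i :: b2)) (simple_root j)).
Proof.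
move=> ua h; elim: h ua b1 => [|k {}a {}b h IH|k {}a {}b h IH d] ua b1 E.
- by case: b1 E.
- case/andP: (ua) => ka ua'; apply: le_trans (IH ua' _ E) _.
  have := nested_sub h; rewrite E all_cat /= all_cat /=.
  case/and5P=> a1 ai a2 aj _.
  rewrite /omega /= !(rho_word_supp (K := mem a)) ?mul0r ?add0r //=.
  by rewrite all_cat /= a1 ai.
have nh := nested_take h d.
have sb := nested_sub nh; have rb := nested_reduced nh.
case: b1 E => [[ei eb]|x b1 [ei eb]].
  subst k b; rewrite wprod_nil rho1 /= /omega /=.
  set y := rho _ _.
  have py : vpos y by apply: reduced_root_pos (i :: b2) j b3 rb.
  rewrite (@euler0r a y (simple_root i)); last first.
    by move=> l la; rewrite ffunE; case: eqP la => // ->; case/andP: ua => /negPf ->.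
  rewrite (@euler0l a (simple_root i) y); last first.
    by move=> l la; rewrite ffunE; case: eqP la => // ->; case/andP: ua => /negPf ->.
  rewrite big_seq big1 ?mulr0 ?add0r ?addr0; last first.
    move=> l la; rewrite ffunE; case: eqP la => [->|_ _]; rewrite ?mulr0 //.
    by case/andP: ua => /negPf ->.
  rewrite ffunE eqxx mul1r oppr_ge0 big_seq; apply: sumr_le0 => l la.
  rewrite mulr_le0_ge0 ?py //; apply: cartan_le0.
  by apply: contraTneq la => <-; case/andP: ua.
subst k; rewrite eb in sb rb.
rewrite cat_cons !wprod_cons !rhoM !rho_simple omega_refl //.
- by apply: IH => //; rewrite rcons_uniq.
- move=> l hl; apply: (rho_word_supp (K := mem (x :: a))) => //.
    by move: sb; rewrite /= all_cat => /andP[_ /andP[]].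
  by move: sb; rewrite /= all_cat /= => /andP[_ /and3P[]].
- move=> l hl; apply: (rho_word_supp (K := mem (x :: a))) => //.
    by move: sb; rewrite /= !all_cat /= all_cat => /andP[_ /andP[-> /and3P[-> ->]]].
  by move: sb; rewrite /= !all_cat /= all_cat => /andP[_ /andP[_ /and3P[_ _ /andP[]]]].
Qed.

Lemma inversion_split b x : isroot x -> vpos x -> vneg (rho (wp b)^-1%g x) ->
  exists b1 r b2, b = b1 ++ r :: b2 /\ x = rho (wp b1) (simple_root r).
Proof.
elim: b x => [|k b IH] x rx px.
  by rewrite wprod_nil invg1 rho1 => /(root_pos_neg rx px).
rewrite wprod_cons rho_simple_mulV => n.
have [->|xk] := eqVneq x (simple_root k).
  by exists [::], k, b; rewrite wprod_nil rho1.
have [b1 [r [b2 [-> e]]]] := IH _ (isroot_refl k rx) (refl_pos rx px xk) n.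
exists (k :: b1), r, b2; split=> //.
by rewrite wprod_cons rhoM rho_simple -e reflK.
Qed.

Lemma rho_faithful w : (forall x, rho w x = x) -> w = 1%g.
Proof.
move=> h; apply/eqP; apply: contraT => /ex_ldesc[i /ldesc_neg].
rewrite -(h (rho _ _)) rhoKV => n.
by case: (root_pos_neg (isroot_simple i) (simple_root_pos i) n).
Qed.

(** Both sides act as the reflection in the same root, and the action is faithful. *)
Lemma simple_conj w r i : rho w (simple_root r) = simple_root i ->
  (w * s r * w^-1 = s i)%g.
Proof.
move=> h; suff e : (w * s r * w^-1 * s i = 1)%g.
  by rewrite -[LHS](simple_mulKr i) e mul1g.
apply: rho_faithful => x; rewrite !rhoM !rho_simple.
have lin (y : V) : rho w (refl r y) =
    [ffun k => rho w y k - pairing r y * rho w (simple_root r) k].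
  apply/ffunP => k; rewrite rhoE ffunE (rhoE w y) -(sum_pick (fun j => rho w (simple_root j) k)).
  rewrite mulr_sumr -sumrB; apply: eq_bigr => j _; rewrite [refl r y j]ffunE; ring.
have P : pairing r (rho w^-1%g (refl i x)) = - pairing i x.
  rewrite -bilinear_simple -(bilinear_rho w) (rhoKV w) h bilinear_simple.
  by rewrite pairing_refl cartan_diag; ring.
rewrite lin (rhoKV w) h P.
by apply/ffunP => k; rewrite !ffunE; ring.
Qed.

(* If [simple_root i] with [i] final is the root of the letter [r] in a nested
   word, every later root is omega-orthogonal to it, hence orthogonal to it, and
   the later letters commute with [r]. *)
Lemma nested_final_commute a i b b1 r b2 : uniq (rcons a i) ->
  nested_word (rcons a i) b -> b = b1 ++ r :: b2 ->
  rho (wp b1) (simple_root r) = simple_root i -> all (fun j => cartan r j == 0) b2.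
Proof.
move=> ua h E hr.
suff H b3 c2 : b2 = b3 ++ c2 -> all (fun j => cartan r j == 0) b3.
  by apply: (H b2 [::]); rewrite cats0.
elim/last_ind: b3 c2 => // b3 j IH c2 hc2.
have hb3 : all (fun j => cartan r j == 0) b3.
  by apply: (IH (j :: c2)); rewrite hc2 cat_rcons.
rewrite all_rcons hb3 andbT.
have Eb : b = b1 ++ r :: b3 ++ j :: c2 by rewrite E hc2 cat_rcons.
have rb := nested_reduced h; have sb := nested_sub h.
set x := rho (wp (b1 ++ r :: b3)) (simple_root j).
have px : vpos x.
  by apply: (@reduced_root_pos _ j c2); rewrite -catA /= -Eb.
have om := nested_omega ua h Eb; rewrite -/x hr in om.
have ia : i \notin a by move: ua; rewrite rcons_uniq => /andP[].
have i0 k : k \in a -> simple_root i k = 0.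
  by move=> ka; rewrite ffunE; case: eqP ka => // ->; rewrite (negPf ia).
have term k : k \in a -> cartan i k * x k <= 0.
  move=> ka; rewrite mulr_le0_ge0 // cartan_le0 //.
  by apply: contraTneq ka => <-.
(* As [i] is last, [omega] of [simple_root i] and [x] is this very sum: nonnegative by
   [nested_omega], with nonpositive terms. *)
have sum0 : \sum_(k <- a) cartan i k * x k = 0.
  apply/eqP; rewrite eq_le; apply/andP; split.
    by rewrite big_seq; apply: sumr_le0.
  move: om; rewrite /omega !euler_rcons (@euler0l a (simple_root i)) //.
  rewrite (@euler0r a _ (simple_root i)) // !add0r [simple_root i i]ffunE eqxx mulr1.
  rewrite [X in _ - X * _]big_seq [X in _ - X * _]big1 ?mul0r ?subr0 // => k ka.
  by rewrite i0 ?mulr0.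
have supp k : k \notin i :: a -> x k = 0.
  move=> hk; apply: (rho_word_supp (K := mem (rcons a i))).
  - by move: sb; rewrite Eb !all_cat /= all_cat => /and3P[-> -> /andP[]].
  - by move: sb; rewrite Eb !all_cat /= all_cat => /and4P[_ _ _ /andP[]].
  - by rewrite /= mem_rcons.
have rx : isroot x by exists (wp (b1 ++ r :: b3)), j.
have ui : uniq (i :: a) by move: ua; rewrite rcons_uniq.
have pix : pairing i x = 2 * x i by rewrite (pairing_supp ui supp) sum0 addr0.
have E3 : x = rho (wp b1) (refl r (rho (wp b3) (simple_root j))).
  by rewrite /x wprod_cat wprod_cons !rhoM rho_simple.
have rc : size (b3 ++ j :: c2) = len (wp (b3 ++ j :: c2)).
  by apply: (@len_suffix (b1 ++ [:: r])); rewrite -catA /= -Eb.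
(* The pairing of [x] with [i] is now [2 * x i], so reflecting would negate this coordinate; but [x]
   differs from [simple_root i], since a reduced word does not repeat a root, and stays positive. *)
have xi0 : x i = 0.
  apply/eqP; rewrite eq_le px andbT leNgt; apply/negP => xi.
  have xs : x != simple_root i.
    apply/eqP => xe; have := reduced_root_pos rc.
    have : refl r (rho (wp b3) (simple_root j)) = simple_root r.
      by rewrite -[LHS](rhoK (wp b1)) -E3 xe -hr rhoK.
    move/(congr1 (refl r)); rewrite reflK refl_simple => -> /(_ r).
    by rewrite !ffunE eqxx oppr_ge0 ler10.
  have := refl_pos rx px xs i; rewrite ffunE eqxx mul1r pix; lra.
(* The letters between [r] and [j] are already orthogonal to [r], so the orthogonality of the two
   roots descends to the letters [r] and [j]. *)
have fixr : rho (wp b3)^-1%g (simple_root r) = simple_root r.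
  rewrite -wprod_rev rho_wprod -(all_rev _ b3) in hb3 *.
  elim: (rev b3) hb3 => //= k c IHc /andP[/eqP ck /IHc ->].
  apply/ffunP => l; rewrite [LHS]ffunE pairing_simple cartan_sym ck mulr0 subr0.
  by [].
have : bilinear (simple_root i) x = 0 by rewrite bilinear_simple pix xi0 mulr0.
rewrite -hr E3 bilinear_rho bilinear_simple pairing_refl cartan_diag.
rewrite -(bilinear_simple r) -(bilinear_rho (wp b3)^-1%g) rhoK fixr bilinear_simple.
by rewrite pairing_simple => h0; apply/eqP; lra.
Qed.

Lemma cartan0_commute r j : cartan r j = 0 -> commute (s r) (s j).
Proof.
move=> h; have rj : r != j.
  by apply: contra_eq_neq h => ->; rewrite cartan_diag pnatr_eq0.
have := wprod_braid r j; rewrite (cartan_eq0 rj h) /= !wprod_cons wprod_nil mulg1 => e.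
have {}e : ((s r * s j) * (s r * s j) = 1)%g by rewrite -e !mulgA.
by apply: (mulIg (s r * s j)%g); rewrite e mulgA simple_mulKr simpleK.
Qed.

(** Let [r] be the letter whose root is [simple_root i]. Deleting it multiplies the product by [s i]
    on the left, and the deletion keeps the word nested because [r] commutes with all that
    follows. *)
Lemma srt_final a i w : uniq (rcons a i) -> srt (rcons a i) w -> ldesc i w ->
  srt (rcons a i) (s i * w)%g.
Proof.
move=> ua [b h <-] d.
have [b1 [r [b2 [E hr]]]] :=
  inversion_split (isroot_simple i) (simple_root_pos i) (ldesc_neg d).
have c0 := nested_final_commute ua h E (esym hr).
have cr : commute (s r) (wp b2).
  elim: (b2) c0 => [|k c IH /= /andP[/eqP /cartan0_commute ck /IH ch]].
    by rewrite /commute wprod_nil mulg1 mul1g.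
  by rewrite wprod_cons; apply: commuteM.
exists (b1 ++ b2).
  apply: nested_remove h E _ cr => //.
  by apply: contraTN c0 => rb; apply/allPn; exists r; rewrite // cartan_diag pnatr_eq0.
rewrite -(simple_conj (esym hr)) E !wprod_cat wprod_cons !mulgA.
by rewrite mulgKV simple_mulKr.
Qed.

(** * Joins of sortable elements *)

Definition is_lub (x y j : W) : Prop :=
  [/\ wle x j, wle y j & forall h, wle x h -> wle y h -> wle j h].

Lemma is_lub_sym x y j : is_lub x y j -> is_lub y x j.
Proof. by case=> h1 h2 h3; split=> // h hy hx; apply: h3. Qed.

Lemma ldesc_le_mull i h x : ~~ ldesc i x -> ldesc i h ->
  wle x (s i * h)%g <-> wle (s i * x)%g h.
Proof.
move=> dx dh; rewrite -{2}(simple_mulK i h); apply: wle_simpleE => //.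
by rewrite ldesc_simple_mul dh.
Qed.

Lemma is_lub_simple_mul i x y j : ~~ ldesc i x -> ~~ ldesc i y -> ~~ ldesc i j ->
  is_lub x y j -> is_lub (s i * x)%g (s i * y)%g (s i * j)%g.
Proof.
move=> dx dy dj [h1 h2 h3]; split; [exact: wle_simple_mul.. |] => h hx hy.
have dh : ldesc i h by apply: wle_ldesc hx _; rewrite ldesc_simple_mul.
by apply/ldesc_le_mull => //; apply: h3; apply/ldesc_le_mull.
Qed.

(** Only [i] can be a descent of [u]; once it is taken, the two letters exchange roles both in the
    element and in the rotated list. *)
Lemma srt_dihedral i t u : in_par (pred2 i t) u -> ~~ ldesc t u -> srt [:: i; t] u.
Proof.
have [n] := ubnP (len u); elim: n i t u => // n IH i t u un pu tu.
have [->|/ex_ldesc[k dk]] := eqVneq u 1%g; first exact: srt1.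
have ki : k = i.
  have /orP[/eqP //|/eqP kt] := ldesc_par pu dk.
  by rewrite kt (negPf tu) in dk.
subst k; rewrite -(simple_mulK i u); apply: srt_take; last first.
  by rewrite ldesc_simple_mul dk.
apply: IH; first by have := len_ldesc dk; len_lia.
  apply: in_parM; first by apply: in_par_simple; rewrite /= eqxx orbT.
  by case: pu => b <- hb; exists b => //; apply: sub_all hb => l /=; rewrite orbC.
by rewrite ldesc_simple_mul dk.
Qed.

(* With [a = i :: t :: a2] and [t] a descent of [y], the join is computed above
   [t], after a rotation of [t], from [y] and the join of [s i] and [s t]; this
   makes it sortable for [t :: a2 ++ [:: i]], and [srt_final] brings [i] back in front. *)
Lemma srt_join_simple N i a y g : uniq (i :: a) ->
  (forall a' x' y' g', uniq a' -> (size a' <= size a)%N -> (len g' <= N)%N ->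
     srt a' x' -> srt a' y' -> wle x' g' -> wle y' g' ->
     exists2 j, srt a' j & is_lub x' y' j) ->
  (forall a' x' y' g', uniq a' -> (size a' <= (size a).+1)%N -> (len g' < N)%N ->
     srt a' x' -> srt a' y' -> wle x' g' -> wle y' g' ->
     exists2 j, srt a' j & is_lub x' y' j) ->
  (len g <= N)%N -> srt a y -> wle y g -> ldesc i g ->
  exists2 j, srt (i :: a) j & is_lub (s i) y j.
Proof.
case: a => [|t a] ua IHa IHN gN sy yg ig.
  exists (s i); first exact: srt_simple.
  case: sy => b hb <-; inversion hb; subst; rewrite wprod_nil.
  by split; [apply: wle_refl | apply: wle1 | ].
case/and3P: (ua) => iat ta ua'.
have it : i != t by apply: contraNneq iat => ->; rewrite mem_head.
have ia : i \notin a by apply: contra iat => ia; rewrite in_cons ia orbT.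
(* If [t] is not a descent, [y] does not use [t], and the join is found with one letter fewer. *)
have [ty|ty] := boolP (ldesc t y); last first.
  have [j sj lj] : exists2 j, srt (i :: a) j & is_lub (s i) y j.
    apply: (IHa _ _ _ g) => //; first by rewrite /= ia.
    - exact: srt_simple.
    - by apply: srt_skip; apply: srt_ldescN sy ty.
    - exact/wle_simple.
  exists j => //; apply: srt_subseq sj.
  exact: (@cat_subseq _ [:: i] a [:: i] _ (subseq_refl _) (subseq_cons a t)).
have tg : ldesc t g := wle_ldesc yg ty.
have [d pd hd] := ex_par_longest (pred2 i t).
have id : ldesc i d by apply: hd; rewrite /= eqxx.
have td : ldesc t d by apply: hd; rewrite /= eqxx orbT.
have dh h : ldesc i h -> ldesc t h -> wle d h.
  by move=> ih th; apply: par_longest_le pd _ => k /orP[/eqP->|/eqP->].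
have sE : a ++ [:: i; t] = rcons (rcons a i) t by rewrite -!cats1 -catA.
have tu : ~~ ldesc t (s t * d)%g by rewrite ldesc_simple_mul td.
have ty' : ~~ ldesc t (s t * y)%g by rewrite ldesc_simple_mul ty.
have su : srt (rcons (rcons a i) t) (s t * d)%g.
  rewrite -sE; apply: (srt_subseq (suffix_subseq _ _)).
  apply: srt_dihedral => //; apply: in_parM pd.
  by apply: in_par_simple; rewrite /= eqxx orbT.
have sy1 : srt (rcons (rcons a i) t) (s t * y)%g.
  apply: (@srt_subseq _ (rcons a t)); last by apply: srt_ldesc => //; rewrite /= ta.
  rewrite -!cats1 -catA; apply: cat_subseq; first exact: subseq_refl.
  exact: (suffix_subseq [:: i] [:: t]).
have [j sj lj] : exists2 j, srt (rcons (rcons a i) t) j &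
    is_lub (s t * d)%g (s t * y)%g j.
  apply: (IHN _ _ _ (s t * g)%g) => //.
  - by rewrite !rcons_uniq ia mem_rcons in_cons negb_or eq_sym it ta.
  - by rewrite !size_rcons.
  - by rewrite -(len_ldesc tg).
  - by apply/ldesc_le_mull; rewrite ?simple_mulK //; apply: dh.
  - by apply/ldesc_le_mull; rewrite ?simple_mulK.
have tj : ~~ ldesc t j.
  have [_ _ /(_ (s t * g)%g) h] := lj.
  have : ~~ ldesc t (s t * g)%g by rewrite ldesc_simple_mul tg.
  apply: contra; apply: wle_ldesc; apply: h.
    by apply/ldesc_le_mull; rewrite ?simple_mulK //; apply: dh.
  by apply/ldesc_le_mull; rewrite ?simple_mulK.
have := is_lub_simple_mul tu ty' tj lj; rewrite !simple_mulK => lw.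
have [dw yw hw] := lw.
have iw : ldesc i (s t * j)%g := wle_ldesc dw id.
exists (s t * j)%g; last first.
  split=> [||h ih yh]; [exact/wle_simple | exact: yw |].
  apply: hw => //; apply: dh; first exact/wle_simple.
  exact: wle_ldesc yh ty.
rewrite -(simple_mulK i (s t * j)%g); apply: srt_take; last first.
  by rewrite ldesc_simple_mul iw.
apply: srt_final => //.
  rewrite rcons_uniq iat /= ta; exact: ua'.
by rewrite rcons_cons; apply: srt_take.
Qed.

Theorem srt_join a x y g : uniq a -> srt a x -> srt a y -> wle x g -> wle y g ->
  exists2 j, srt a j & is_lub x y j.
Proof.
have nilP w : srt [::] w -> w = 1%g.
  by case=> b hb <-; inversion hb; rewrite wprod_nil.
suff H N n : forall b x' y' g', uniq b -> (size b <= n)%N -> (len g' <= N)%N ->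
    srt b x' -> srt b y' -> wle x' g' -> wle y' g' ->
    exists2 j, srt b j & is_lub x' y' j.
  by move=> ua; apply: (H (len g) (size a)).
(* Rotation shortens the upper bound and keeps the number of letters; dropping a letter keeps the
   upper bound. Hence the lexicographic induction. *)
elim: N n => [|N IHN] n; last elim: n => [|n IHn].
- move=> b x' y' g' _ _ g0 _ _; have -> : g' = 1%g by apply: len_eq0; apply/eqP; rewrite -leqn0.
  move=> /wle_anti-/(_ (wle1 _)) -> /wle_anti-/(_ (wle1 _)) ->.
  by exists 1%g; [apply: srt1 | split].
- move=> [|//] x' y' g' _ _ _ /nilP -> /nilP -> _ _.
  by exists 1%g; [apply: srt1 | split].
move=> [|i b] x' y' g' ub bn gN sx sy xg yg; first exact: (IHn [::] x' y' g').
have both z' z : srt (i :: b) z' -> wle z' g' -> ldesc i z' ->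
    srt (i :: b) z -> wle z g' -> ldesc i z ->
    exists2 j, srt (i :: b) j & is_lub z' z j.
  move=> sz' zg' ix sz zg iz; have ig := wle_ldesc zg iz.
  have nx : ~~ ldesc i (s i * z')%g by rewrite ldesc_simple_mul ix.
  have nz : ~~ ldesc i (s i * z)%g by rewrite ldesc_simple_mul iz.
  have hx : wle (s i * z')%g (s i * g')%g by apply/ldesc_le_mull; rewrite ?simple_mulK.
  have hz : wle (s i * z)%g (s i * g')%g by apply/ldesc_le_mull; rewrite ?simple_mulK.
  have [j sj lj] : exists2 j, srt (rcons b i) j & is_lub (s i * z')%g (s i * z)%g j.
    apply: (IHN n.+1 _ _ _ (s i * g')%g) => //.
    - by rewrite rcons_uniq.
    - by rewrite size_rcons.
    - by rewrite -ltnS -(len_ldesc ig).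
    - exact: srt_ldesc.
    - exact: srt_ldesc.
  have nj : ~~ ldesc i j.
    have [_ _ /(_ (s i * g')%g) h] := lj.
    have : ~~ ldesc i (s i * g')%g by rewrite ldesc_simple_mul ig.
    by apply: contra; apply: wle_ldesc; apply: h.
  exists (s i * j)%g; first exact: srt_take.
  by have := is_lub_simple_mul nx nz nj lj; rewrite !simple_mulK.
have mixed z : srt b z -> wle z g' -> ldesc i g' ->
    exists2 j, srt (i :: b) j & is_lub (s i) z j.
  move=> sz zg ig; apply: (srt_join_simple (N := N.+1) (g := g')) => //.
    move=> a' x1 y1 g1 ua' la lg; apply: IHn => //; move: la bn => /=; lia.
  move=> a' x1 y1 g1 ua' la lg; apply: (IHN n.+1) => //; move: la bn => /=; lia.
(* As [z] lies above [s i], its join with [z'] is its join with [s i \/ z'], and both arguments then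
   have the descent [i]. *)
have up z z' : ldesc i z -> ~~ ldesc i z' -> srt (i :: b) z' -> wle z g' ->
    wle z' g' -> exists j, [/\ srt (i :: b) j, ldesc i j, wle j g' &
      forall k, is_lub z j k -> is_lub z z' k].
  move=> iz iz' sz' zg zg'; have ig := wle_ldesc zg iz.
  have [j sj [h1 h2 h3]] := mixed z' (srt_ldescN sz' iz') zg' ig.
  exists j; split=> //; first exact/wle_simple.
    by apply: h3 => //; apply/wle_simple.
  move=> k [k1 k2 k3]; split=> // [|h hz hz']; first exact: wle_trans h2 k2.
  by apply: k3 => //; apply: h3 => //; apply/wle_simple/(wle_ldesc hz).
have [ix|ix] := boolP (ldesc i x'); have [iy|iy] := boolP (ldesc i y').
- exact: both.
- have [j [sj ij jg hj]] := up _ _ ix iy sy xg yg.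
  have [k sk lk] := both x' j sx xg ix sj jg ij.
  by exists k => //; apply: hj.
- have [j [sj ij jg hj]] := up _ _ iy ix sx yg xg.
  have [k sk lk] := both y' j sy yg iy sj jg ij.
  by exists k => //; apply/is_lub_sym/hj.
- have [j sj lj] : exists2 j, srt b j & is_lub x' y' j.
    apply: (IHn _ _ _ g') => //; first by case/andP: ub.
    + exact: srt_ldescN sx ix.
    + exact: srt_ldescN sy iy.
  by exists j => //; apply: srt_skip.
Qed.

(** A longest sortable element below [z] absorbs any other: their join is again sortable and below
    [z], hence no longer. *)
Lemma srt_max_le a z : uniq a ->
  exists r, [/\ srt a r, wle r z & forall y, srt a y -> wle y z -> wle y r].
Proof.
move=> ua; have [r [sr rz] hr] :=
  @ex_max_len (fun r => srt a r /\ wle r z) 1%g (conj (srt1 a) (@wle1 z)).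
exists r; split=> // y sy yz; have [j sj [rj yj hj]] := srt_join ua sr sy rz yz.
have -> : r = j by apply: wle_len_anti => //; apply: hr; split=> //; apply: hj.
exact: yj.
Qed.

Lemma ldescN_srt i a w : uniq (i :: a) -> srt a w -> ~~ ldesc i w.
Proof.
move=> /andP[ia _] /srt_par pw; apply: contra ia => /(ldesc_par pw).
by [].
Qed.

(** * Boolean retracts of Cambrian intervals *)

Definition srt_interval (a : seq I) (u v z : W) := [/\ srt a z, wle u z & wle z v].

Lemma ex_longest : exists g, forall w, wle w g.
Proof.
have [g _ hg] := ex_par_longest predT; exists g => w.
by apply: (par_longest_le (K := predT)) => //; exists (word_of w);
  [apply: wprod_word_of | apply/allP].
Qed.

Lemma boolean_retract_simple_mul a i u v (D : {set I}) phi psi : uniq (i :: a) -> ldesc i u ->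
  ldesc i v ->
  boolean_retract wle (srt_interval (rcons a i) (s i * u)%g (s i * v)%g)
    (s i * u)%g D phi psi ->
  boolean_retract wle (srt_interval (i :: a) u v) u D
    (fun z => phi (s i * z)%g) (fun A => (s i * psi A)%g).
Proof.
move=> ua iu iv [h1 h2 h3 h4 h5 h6 h7 h8].
have dw w : ldesc i w -> ~~ ldesc i (s i * w)%g.
  by move=> iw; rewrite ldesc_simple_mul iw.
have Cd z : srt_interval (i :: a) u v z -> ldesc i z.
  by case=> _ uz _; apply: wle_ldesc uz iu.
have C1 z : srt_interval (i :: a) u v z ->
    srt_interval (rcons a i) (s i * u)%g (s i * v)%g (s i * z)%g.
  move=> Cz; have iz := Cd z Cz; case: Cz => sz uz zv; split.
  - exact: srt_ldesc.
  - by apply/ldesc_le_mull; rewrite ?simple_mulK ?dw.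
  - by apply/ldesc_le_mull; rewrite ?simple_mulK ?dw.
have C2d z : srt_interval (rcons a i) (s i * u)%g (s i * v)%g z -> ~~ ldesc i z.
  by case=> _ _ zv; apply: contra (dw v iv); apply: wle_ldesc.
have C2 z : srt_interval (rcons a i) (s i * u)%g (s i * v)%g z ->
    srt_interval (i :: a) u v (s i * z)%g.
  move=> Cz; have iz := C2d z Cz; case: Cz => sz uz zv; split.
  - exact: srt_take.
  - by have := wle_simple_mul iz uz; rewrite simple_mulK.
  - exact/(ldesc_le_mull iz iv).
split=> [z /C1 /h1 //|z z' Cz Cz' zz'|A /h3 /C2 //|A B DB AB|z Cz|A DA|z Cz h|].
- apply: h2; [exact: C1 | exact: C1 |].
  by apply/ldesc_le_mull; rewrite ?simple_mulK ?dw ?Cd.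
- by apply: wle_simple_mul (h4 _ _ DB AB); apply/C2d/h3.
- have hz := h5 _ (C1 _ Cz).
  by apply/ldesc_le_mull => //; [apply/C2d/h3/h1/C1 | apply: Cd].
- by rewrite simple_mulK h6.
- by have := h7 _ (C1 _ Cz) h; apply: mulgI.
- by rewrite h8 simple_mulK.
Qed.

(** The atom [i] is added. On the elements above [s i] the old retract is transported along [q z],
    the largest sortable element of [W_J] below [z], and its section [f z], the join of [s i] and
    [z]. *)
Lemma boolean_retract_join a i u v r (D : {set I}) phi psi : uniq (i :: a) ->
  srt a u -> ldesc i v -> wle u v ->
  srt a r -> wle r v -> (forall y, srt a y -> wle y v -> wle y r) ->
  {subset D <= a} ->
  boolean_retract wle (srt_interval a u r) u D phi psi ->
  exists phi' psi', boolean_retract wle (srt_interval (i :: a) u v) u (i |: D)%SET phi' psi'.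
Proof.
move=> ui su iv uv sr rv hr Da [h1 h2 h3 h4 h5 h6 h7 h8].
have ua : uniq a by case/andP: ui.
have ia : i \notin a by case/andP: ui.
(* The longest element is the common upper bound that [srt_join] asks for. *)
have [g0 hg0] := ex_longest.
have [f hf] : {f : W -> W & forall z, srt a z -> srt (i :: a) (f z) /\ is_lub (s i) z (f z)}.
  apply: (boolp.choice (P := fun z j => srt a z -> srt (i :: a) j /\ is_lub (s i) z j)) => z; case: (pselect (srt a z)) => [sz|]; last by exists 1%g.
  have [j sj lj] := srt_join ui (srt_simple i a) (srt_skip i sz) (hg0 _) (hg0 _).
  by exists j.
have [q hq] := boolp.choice (fun z => srt_max_le z ua).
have sq z : srt a (q z) by case: (hq z).
have qz z : wle (q z) z by case: (hq z).
have lq y z : srt a y -> wle y z -> wle y (q z) by case: (hq z) => _ _; apply.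
have fi z : srt a z -> ldesc i (f z) by move=> /hf[_ [/wle_simple]].
have zf z : srt a z -> wle z (f z) by move=> /hf[_ []].
have lf z h : srt a z -> ldesc i h -> wle z h -> wle (f z) h.
  by move=> /hf[_ [_ _ hh]] ih zh; apply: hh => //; apply/wle_simple.
have qf z : srt a z -> q (f z) = z.
  move=> sz; apply: wle_anti; last by apply: lq => //; apply: zf.
  (* [g] dominates [f z], and every element of [W_J] below [g] is already below [z]; so joining with
     [s i] brings in nothing new from [W_J]. *)
  have [g [zg ig hg]] := par_cap_upper (srt_par sz) ia.
  by apply: hg; [apply: srt_par | apply: wle_trans (qz _) _; apply: lf].
have qr z : wle z v -> wle (q z) r by move=> zv; apply: hr => //; apply: wle_trans (qz _) zv.
have Cq z : srt_interval (i :: a) u v z -> srt_interval a u r (q z).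
  by case=> sz uz zv; split=> //; [apply: lq | apply: qr].
have CN z : srt_interval (i :: a) u v z -> ~~ ldesc i z -> srt_interval a u r z.
  by case=> sz uz zv iz; have sz' := srt_ldescN sz iz; split=> //; apply: hr.
have CI z : srt_interval a u r z -> srt_interval (i :: a) u v z.
  by case=> sz uz zr; split=> //; [apply: srt_skip | apply: wle_trans zr rv].
have Cf z : srt_interval a u r z -> srt_interval (i :: a) u v (f z).
  case=> sz uz zr; split; first by case: (hf z sz).
    exact: wle_trans uz (zf _ sz).
  by apply: lf => //; apply: wle_trans zr rv.
have iD : i \notin D by apply: contra ia => /Da.
have D1 (A : {set I}) : A \subset (i |: D)%SET -> (A :\ i)%SET \subset D.
  by move=> AD; rewrite finset.subDset.
have D0 (A : {set I}) : A \subset (i |: D)%SET -> i \notin A -> A \subset D.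
  move=> /fintype.subsetP AD iA; apply/fintype.subsetP => k kA.
  by have /finset.setU1P[ki|//] := AD k kA; rewrite -ki kA in iA.
exists (fun z => if ldesc i z then (i |: phi (q z))%SET else phi z).
exists (fun A : {set I} => if i \in A then f (psi (A :\ i)%SET) else psi A).
split.
- move=> z Cz; case: ifP => iz; first by apply/finset.setUS/h1/Cq.
  by apply: fintype.subset_trans (finset.subsetUr _ _); apply/h1/CN; rewrite ?iz.
- move=> z z' Cz Cz' zz'; case: ifP => iz; case: ifP => iz'.
  + by apply/finset.setUS/h2; [apply: Cq | apply: Cq | apply: lq => //; apply: wle_trans (qz _) zz'].
  + by rewrite (wle_ldesc zz' iz) in iz'.
  + apply: fintype.subset_trans (finset.subsetUr _ _); apply: h2; [exact: CN (negbT iz) | exact: Cq |].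
    by apply: lq => //; case: (CN z Cz (negbT iz)).
  + by apply: h2 => //; apply: CN; rewrite ?iz ?iz'.
- move=> A AD; case: ifP => iA; first by apply/Cf/h3/D1.
  by apply/CI/h3/D0; rewrite ?iA.
- move=> A B BD AB; have AD := fintype.subset_trans AB BD.
  have sp (E : {set I}) : E \subset D -> srt a (psi E) by move=> /h3[].
  case: ifP => iA; case: ifP => iB.
  + apply: lf; [by apply/sp/D1 | by apply/fi/sp/D1 |].
    apply: (@wle_trans (psi (B :\ i)%SET)); last by apply/zf/sp/D1.
    by apply: h4; [apply: D1 | apply: finset.setSD].
  + by rewrite (fintype.subsetP AB i iA) in iB.
  + apply: (@wle_trans (psi (B :\ i)%SET)); last by apply/zf/sp/D1.
    by apply: h4; [apply: D1 | rewrite finset.subsetD1 AB iA].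
  + by apply: h4 => //; apply: D0; rewrite ?iB.
- move=> z Cz /=; case iz: (ldesc i z).
    rewrite finset.setU11 finset.setU1K; last by apply: contra iD; apply/fintype.subsetP/h1/Cq.
    apply: lf => //; first by case: (h3 _ (h1 _ (Cq _ Cz))).
    by apply: wle_trans (qz z); apply/h5/Cq.
  have Cz' := CN z Cz (negbT iz).
  have -> : (i \in phi z) = false by apply: contraNF iD; apply/fintype.subsetP/h1.
  exact: h5.
- move=> A AD /=; case iA: (i \in A).
    have sp : srt a (psi (A :\ i)%SET) by case: (h3 _ (D1 _ AD)).
    by rewrite fi // qf // h6 ?D1 // finset.setD1K.
  have AD' := D0 A AD (negbT iA).
  have /negPf -> : ~~ ldesc i (psi A) by apply: (ldescN_srt ui); case: (h3 _ AD').
  exact: h6.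
- move=> z Cz; case: ifP => iz; last by apply: h7; apply: CN; rewrite ?iz.
  by move/finset.setP/(_ i); rewrite finset.setU11 inE.
- by rewrite inE.
Qed.

Theorem srt_boolean_retract a u v : uniq a -> srt a u -> srt a v -> wle u v ->
  exists (D : {set I}) phi psi,
    boolean_retract wle (srt_interval a u v) u D phi psi /\ {subset D <= a}.
Proof.
(* Rotation shortens [v] with as many letters; dropping a letter replaces [v] by an element that is
   no longer. *)
have [n] := ubnP (len v + size a); elim: n a u v => // n IH [|i a] u v hn ua su sv uv.
  have nilP w : srt [::] w -> w = 1%g.
    by case=> b hb <-; inversion hb; rewrite wprod_nil.
  exists finset.set0, (fun=> finset.set0), (fun=> 1%g); split; last by move=> k; rewrite inE.
  split=> //.
  - by move=> A _; split; [apply: srt1 | rewrite (nilP _ su) | rewrite (nilP _ sv)].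
  - by move=> A B _ _; apply: wle_refl.
  - by move=> z _; apply: wle1.
  - by move=> A; rewrite finset.subset0 => /eqP.
  - by move=> z [sz _ _] _; rewrite (nilP _ sz) (nilP _ su).
  - by rewrite (nilP _ su).
have ua' : uniq a by case/andP: ua.
have [iu|iu] := boolP (ldesc i u).
  have iv := wle_ldesc uv iu.
  have [|||||D [phi [psi [h Da]]]] := IH (rcons a i) (s i * u)%g (s i * v)%g.
  - by move: hn; rewrite size_rcons (len_ldesc iv).
  - by rewrite rcons_uniq.
  - exact: srt_ldesc.
  - exact: srt_ldesc.
  - by apply/ldesc_le_mull; rewrite ?simple_mulK ?ldesc_simple_mul ?iu.
  exists D, (fun z => phi (s i * z)%g), (fun A => (s i * psi A)%g); split.
    exact: boolean_retract_simple_mul.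
  by move=> k /Da; rewrite mem_rcons.
have su' := srt_ldescN su iu.
have [iv|iv] := boolP (ldesc i v).
  have [r [sr rv hr]] := srt_max_le v ua'.
  have [|||||D [phi [psi [h Da]]]] := IH a u r => //.
  - by move: hn (wle_leq_len rv) => /=; len_lia.
  - exact: hr.
  have [phi' [psi' h']] := boolean_retract_join ua su' iv uv sr rv hr Da h.
  exists (i |: D)%SET, phi', psi'; split=> // k /finset.setU1P[->|/Da ka].
    exact: mem_head.
  by rewrite in_cons ka orbT.
have [|||||D [phi [psi [h Da]]]] := IH a u v => //.
- by move: hn => /=; len_lia.
- exact: srt_ldescN sv iv.
exists D, phi, psi; split; last by move=> k /Da ka; rewrite in_cons ka orbT.
have CN z : srt_interval (i :: a) u v z <-> srt_interval a u v z.
  split=> -[sz uz zv]; split=> //; last exact: srt_skip.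
  by apply: srt_ldescN sz _; apply: contra iv; apply: wle_ldesc.
case: h => h1 h2 h3 h4 h5 h6 h7 h8; split=> //.
- by move=> z /CN /h1.
- by move=> z z' /CN Cz /CN; apply: h2.
- by move=> A /h3 /CN.
- by move=> z /CN /h5.
- by move=> z /CN /h7.
Qed.

(** * Sorting words are nested words *)

Section SortingWords.
Variable a : seq I.
Hypothesis ha : perm_eq a (enum I).

Let n := size a.

Let a_uniq : uniq a.
Proof. by rewrite (perm_uniq ha) enum_uniq. Qed.

Let mem_a i : i \in a.
Proof. by rewrite (perm_mem ha) mem_enum. Qed.

Notation pos := (a_pos a).

Lemma a_pos_inj : injective pos.
Proof.
move=> [k i] [l j]; rewrite /a_pos /= => e.
have hi : (index i a < n)%N by rewrite index_mem.
have hj : (index j a < n)%N by rewrite index_mem.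
have kl : k = l.
  have n0 : (0 < n)%N by lia.
  by have := congr1 (fun x => x %/ n)%N e; rewrite !divnMDl // !divn_small // !addn0.
move: e; rewrite kl => /addnI e; congr (_, _).
by rewrite -(nth_index i (mem_a i)) e nth_index.
Qed.

Lemma a_posS k i : pos (k.+1, i) = (pos (k, i) + n)%N.
Proof. by rewrite /a_pos /= mulSn; lia. Qed.

(** Among [n] consecutive positions of the periodic word, each letter occurs once. *)
Lemma a_pos_window M c c' : c.2 = c'.2 ->
  (M <= pos c < M + n)%N -> (M <= pos c' < M + n)%N -> pos c = pos c'.
Proof.
case: c c' => [k i] [l j] /= ->; rewrite /a_pos /=; set r := index j a => h1 h2.
have -> : k = l; last by [].
by nia.
Qed.

(* A letter [i] of the k-th copy of [a] is a cell [(k, i)]; taking it makes the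
   cell [(k.+1, i)] available, so that [q] stays inside a window of length [n]. *)
Inductive nested_cells : seq (nat * I) -> seq (nat * I) -> Prop :=
| cells_nil : nested_cells [::] [::]
| cells_skip c q p : nested_cells q p -> nested_cells (c :: q) p
| cells_take k i q p : nested_cells (rcons q (k.+1, i)) p ->
    ~~ ldesc i (wp (map snd p)) -> nested_cells ((k, i) :: q) ((k, i) :: p).

Lemma nested_cells_word q p : nested_cells q p ->
  nested_word (map snd q) (map snd p).
Proof.
elim=> [|c {}q {}p _ IH|k i {}q {}p _ IH d] /=; first exact: nested_nil.
  exact: nested_skip.
by apply: nested_take => //; move: IH; rewrite map_rcons.
Qed.

Lemma nested_word_cells q b : nested_word (map snd q) b ->
  exists2 p, nested_cells q p & map snd p = b.
Proof.
move: {2}(map snd q) (erefl (map snd q)) => a' e; rewrite e => h.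
elim: h q e => [|i {}a' {}b _ IH|i {}a' {}b _ IH d] q.
- by case: q => // _; exists [::]; first exact: cells_nil.
- case: q => // c q [_ e]; have [p hp <-] := IH q e.
  by exists p => //; apply: cells_skip.
- case: q => // -[k j] q [/= ej e]; subst j.
  have [|p hp hb] := IH (rcons q (k.+1, i)); first by rewrite map_rcons e.
  exists ((k, i) :: p); last by rewrite /= hb.
  by apply: cells_take => //; rewrite hb.
Qed.

Definition window (M : nat) (q : seq (nat * I)) : bool :=
  sorted ltn (map pos q) && all (fun c => M <= pos c < M + n)%N q.

Lemma window_behead M c q : window M (c :: q) -> window M q.
Proof.
rewrite /window /= => /andP[/path_sorted -> /andP[_ ->]].
by [].
Qed.

Lemma window_take M k i q : window M ((k, i) :: q) ->
  window (pos (k, i)).+1 (rcons q (k.+1, i)).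
Proof.
rewrite /window !(sorted_pairwise ltn_trans) /= => /and3P[/andP[h1 h2] /andP[h3 h4] h5].
have {}h1 : all (fun c => pos (k, i) < pos c)%N q by rewrite -all_map.
rewrite map_rcons pairwise_rcons h2 all_rcons a_posS andbT all_map.
have hn : (0 < n)%N by have := mem_a i; rewrite -index_mem -/n; lia.
apply/and3P; split; [|lia|]; apply/allP => c cq /=;
  by have := allP h1 c cq; have /andP[] := allP h5 c cq; lia.
Qed.

Lemma nested_cells_sorted M q p : window M q -> nested_cells q p ->
  sorted ltn (map pos p) && all (fun c => M <= pos c)%N p.
Proof.
move=> wq h; elim: h M wq => [//|c {}q {}p _ IH|k i {}q {}p _ IH d] M wq.
  exact: IH (window_behead wq).
have /andP[h1 h2] := IH _ (window_take wq).
have /andP[_ /andP[/andP[h3 _] _]] := wq.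
rewrite (sorted_pairwise ltn_trans) /= -(sorted_pairwise ltn_trans) h1 h3 all_map h2 /=.
by apply/allP => c /(allP h2); lia.
Qed.

Lemma nested_cells_pred q p k i : nested_cells q p ->
  (k.+1, i) \in p -> (k.+1, i) \in q \/ (k, i) \in p.
Proof.
elim=> [//|c {}q {}p _ IH /IH [h|h]|l j {}q {}p _ IH _].
- by left; rewrite in_cons h orbT.
- by right.
rewrite !in_cons => /orP[->|/IH [|h]]; first by left.
  rewrite mem_rcons in_cons => /orP[/eqP[-> ->]|h].
    by right; rewrite eqxx.
  by left; rewrite h orbT.
by right; rewrite h orbT.
Qed.

(** The first letter of a competing reduced word is a descent, so it still occurs in [q]. If its
    cell came before [(k, i)], it would lie in the window and hence be that cell of [q]; but
    [(k, i)] is the first cell of [q]. *)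
Lemma nested_cells_lexi M q p p' : window M q -> nested_cells q p ->
  sorted ltn (map pos p') -> all (fun c => M <= pos c)%N p' ->
  reduced_word s (wp (map snd p)) (map snd p') ->
  ((map pos p : seqlexi nat) <= (map pos p' : seqlexi nat))%O.
Proof.
move=> wq h; elim: h M wq p' => [M _ p' _ _ _|c {}q {}p _ IH|k i {}q {}p h IH d] /=.
- exact: lexi0s.
- by move=> M wq p' sp' Mp'; apply: IH (window_behead wq) p' sp' Mp'.
move=> M wq p' sp' Mp' /reduced_wordP[ep' lp'].
have nh := nested_cells_word (cells_take h d).
have rh := nested_reduced nh.
case: p' sp' Mp' ep' lp' => [|x p'] sp' Mp' ep' lp'.
  by move: lp'; rewrite -[wprod s _]/(wp (map snd ((k, i) :: p))) -rh.
have ld : ldesc x.2 (wp (map snd ((k, i) :: p))).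
  by rewrite -[wp _]ep'; apply: ldesc_wprod; rewrite [RHS](congr1 len ep').
have xq : x.2 \in map snd ((k, i) :: q).
  by apply: (ldesc_par (K := mem (map snd ((k, i) :: q))) _ ld); apply: srt_par; eexists; last by [].
rewrite [map pos (x :: p')]/= lexi_cons; case: (ltngtP (pos (k, i)) (pos x)) => [lt|gt|eq].
- by rewrite !leEnat (ltnW lt) leqNgt lt.
- exfalso; move/mapP: xq => [c cq xc].
  have /andP[sq /allP wq'] := wq.
  have hx : (M <= pos x < M + n)%N.
    have := wq' (k, i) (mem_head _ _); case/andP: Mp' => -> _; lia.
  have e := a_pos_window xc hx (wq' c cq).
  move: cq; rewrite in_cons => /orP[/eqP ck|cq]; first by move: gt; rewrite e ck ltnn.
  move: sq; rewrite (sorted_pairwise ltn_trans) /= => /andP[/allP sq _].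
  by have := sq _ (map_f pos cq); rewrite -e; lia.
- have xki := a_pos_inj eq; subst x; rewrite lexx /=.
  move: sp'; rewrite (sorted_pairwise ltn_trans) /= -(sorted_pairwise ltn_trans) => /andP[al sp'].
  apply: (IH _ (window_take wq)) => //; first by rewrite -all_map.
  apply/reduced_wordP; split.
    by move: ep'; rewrite !wprod_cons; apply: mulgI.
  move: lp'; rewrite /= wprod_cons (len_ldescN d).
  by case.
Qed.

Lemma reduced_nested_cells M q p : window M q -> sorted ltn (map pos p) ->
  all (fun c => M <= pos c)%N p -> size p = len (wp (map snd p)) ->
  (forall k i, (k, i) \in p -> (k, i) \in q \/ (exists2 l, k = l.+1 & (l, i) \in p)) ->
  nested_cells q p.
Proof.
have [b] := ubnP (size q + (size p) * 2); elim: b M q p => // b IH M q p hb wq sp Mp rp hp.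
(* A predecessor of the first cell of [p] would have a smaller position, so it cannot be in [p]. *)
have first_q x p' : p = x :: p' -> x \in q.
  move=> e; case: x e => k i e; have kip : (k, i) \in p by rewrite e mem_head.
  have [//|[l kl lp]] := hp k i kip.
  move: lp; rewrite e in_cons => /orP[/eqP[lk]|lp]; first by lia.
  move: sp; rewrite e (sorted_pairwise ltn_trans) /= => /andP[/allP al _].
  by have := al _ (map_f pos lp); rewrite kl a_posS /=; lia.
case: q hb wq hp first_q => [|[k i] q] hb wq hp first_q.
  case: p {hb sp Mp rp hp} first_q => [_|x p' /(_ x p' erefl)]; last by rewrite in_nil.
  exact: cells_nil.
have [xp|xp] := boolP ((k, i) \in p); last first.
  apply: cells_skip; apply: (IH M) => //.
    exact: window_behead wq.
  move=> l j lp; have [|] := hp l j lp; last by right.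
  rewrite in_cons => /orP[/eqP e|]; last by left.
  by rewrite -e lp in xp.
case: p hb sp Mp rp hp first_q xp => [|x p] hb sp Mp rp hp first_q xp.
  by rewrite in_nil in xp.
have ex : x = (k, i).
  move: xp; rewrite in_cons => /orP[/eqP -> //|xp].
  have := first_q x p erefl; rewrite in_cons => /orP[/eqP //|xq]; exfalso.
  move: sp; rewrite (sorted_pairwise ltn_trans) /= => /andP[/allP al _].
  have /andP[sq _] := wq.
  move: sq; rewrite (sorted_pairwise ltn_trans) /= => /andP[/allP al' _].
  by have := al _ (map_f pos xp); have := al' _ (map_f pos xq) => /=; lia.
subst x; move: sp; rewrite (sorted_pairwise ltn_trans) /= -(sorted_pairwise ltn_trans).
case/andP=> al sp.
have rp' : size p = len (wp (map snd p)).
  by have := @len_suffix [:: i] (map snd p); rewrite /= !size_map => ->.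
apply: cells_take.
  apply: (IH (pos (k, i)).+1) => //.
  - by move: hb; rewrite /= size_rcons; move: (size q) (size p) => *; lia.
  - exact: window_take wq.
  - by rewrite -all_map.
  move=> l j lp; have [||[l' ll lp']] := hp l j.
  - by rewrite in_cons lp orbT.
  - rewrite in_cons => /orP[/eqP [lk ji]|lq]; last by left; rewrite mem_rcons in_cons lq orbT.
    subst l j; have := allP al _ (map_f pos lp).
    by rewrite ltnn.
  - move: lp'; rewrite in_cons => /orP[/eqP [lk ji]|lq]; last by right; exists l'.
    by left; rewrite ll lk ji mem_rcons mem_head.
rewrite /ldesc -wprod_cons; move: rp; rewrite /= => <-; rewrite -rp'; lia.
Qed.

Theorem sortable_srt w : sortable s a w <-> srt a w.
Proof.
(* The first copy of [a] is the initial window. *)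
pose q0 := [seq (0%N, i) | i <- a].
have sq0 : map snd q0 = a by rewrite /q0 -map_comp map_id.
have wq0 : window 0 q0.
  rewrite /window; apply/andP; split.
    rewrite /q0 -map_comp.
    have -> : map (pos \o pair 0%N) a = iota 0 n.
      apply: (@eq_from_nth _ 0%N) => [|k]; rewrite size_map ?size_iota // => kn.
      have [x0 _] : exists x0 : I, true by move: kn; case: (a) => // x0; exists x0.
      rewrite (nth_map x0) // nth_iota //= /a_pos /= mul0n !add0n.
      by rewrite index_uniq.
    exact: iota_ltn_sorted.
  apply/allP => c /mapP[i _ ->]; rewrite /a_pos /= mul0n add0n.
  by rewrite index_mem.
split.
  move=> [p [[sp /reduced_wordP[pw pl]] _] nest].
  exists (map snd p) => //; rewrite -{1}sq0; apply: nested_cells_word.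
  apply: (reduced_nested_cells wq0) => //.
  - exact/allP.
  - by move: pl; rewrite size_map pw.
  move=> [|k] i kp; first by left; apply/mapP; exists i.
  right; exists k => //; have /fintype.subsetP/(_ i) := nest k.
  by rewrite !inE; apply.
case=> b; rewrite -{1}sq0 => /nested_word_cells[p hp <-] pw.
have rp := nested_reduced (nested_cells_word hp).
exists p; last first.
  move=> k; apply/fintype.subsetP => i; rewrite !inE => /(nested_cells_pred hp)[|//].
  by case/mapP.
have /andP[sp _] := nested_cells_sorted wq0 hp.
split; first by split=> //; apply/reduced_wordP; rewrite -pw.
move=> p' [sp' rp']; apply: (nested_cells_lexi wq0 hp sp') => //; first exact/allP.
by rewrite pw.
Qed.

End SortingWords.

End GeometricRepresentation.

(** * Order complexes *)

Section ContinuousFunctions.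
Variables (R : realType) (S : topologicalType).
Implicit Types f g : S -> R.

Lemma ctsD f g : continuous f -> continuous g -> continuous (fun x => f x + g x).
Proof. by move=> cf cg x; apply: cvgD; [apply: cf | apply: cg]. Qed.

Lemma ctsB f g : continuous f -> continuous g -> continuous (fun x => f x - g x).
Proof. by move=> cf cg x; apply: cvgB; [apply: cf | apply: cg]. Qed.

Lemma ctsM f g : continuous f -> continuous g -> continuous (fun x => f x * g x).
Proof. by move=> cf cg x; apply: cvgM; [apply: cf | apply: cg]. Qed.

Lemma cts_cst (c : R) : continuous (fun _ : S => c).
Proof. by move=> x; apply: cvg_cst. Qed.

Lemma ctsV f : (forall x, f x != 0) -> continuous f -> continuous (fun x => (f x)^-1).
Proof. by move=> f0 cf x; apply: cvgV; [apply: f0 | apply: cf]. Qed.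

Lemma cts_min f g : continuous f -> continuous g -> continuous (fun x => Num.min (f x) (g x)).
Proof. by move=> cf cg x; apply: (@continuous_min _ _ f g); [apply: cf | apply: cg]. Qed.

Lemma cts_max f g : continuous f -> continuous g -> continuous (fun x => Num.max (f x) (g x)).
Proof. by move=> cf cg x; apply: (@continuous_max _ _ f g); [apply: cf | apply: cg]. Qed.

Lemma cts_sqrt f : continuous f -> continuous (fun x => Num.sqrt (f x)).
Proof.
by move=> cf x; apply: (@continuous_comp _ _ _ f Num.sqrt);
  [apply: cf | apply: sqrt_continuous].
Qed.

Lemma cts_sum (J : Type) (r : seq J) (P : pred J) (f : J -> S -> R) :
  (forall j, P j -> continuous (f j)) -> continuous (fun x => \sum_(j <- r | P j) f j x).
Proof.
move=> cf; elim: r => [|j r IH].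
  by under eq_fun do rewrite big_nil; apply: cts_cst.
under eq_fun do rewrite big_cons; case: (boolP (P j)) => Pj //.
by apply: ctsD => //; apply: cf.
Qed.

Lemma cts_prod (J : Type) (r : seq J) (P : pred J) (f : J -> S -> R) :
  (forall j, P j -> continuous (f j)) -> continuous (fun x => \prod_(j <- r | P j) f j x).
Proof.
move=> cf; elim: r => [|j r IH].
  by under eq_fun do rewrite big_nil; apply: cts_cst.
under eq_fun do rewrite big_cons; case: (boolP (P j)) => Pj //.
by apply: ctsM => //; apply: cf.
Qed.

Lemma cts_rV n (f : S -> 'rV[R]_n) : (forall j, continuous (fun x => f x ord0 j)) -> continuous f.
Proof.
move=> cf x A [P hP sPA]; rewrite /nbhs /=.
have : \forall y \near x, forall j, P ord0 j (f y ord0 j).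
  by apply: filter_forall => j; apply: (cf j x); apply: hP.
apply: filterS => y hy; apply: sPA => i j.
by rewrite (ord1 i).
Qed.

Lemma cts_lift (X : topologicalType) (B : set X) (f : S -> X) (hf : forall x, f x \in B) :
  continuous f -> continuous (fun x => exist (fun y => y \in B) (f x) (hf x) : set_type B).
Proof. by move=> cf; apply: continuous_comp_initial. Qed.

End ContinuousFunctions.

(** * Deformation of an order complex along a decreasing map *)

Section OrderComplexHomotopy.
Variables (R : realType) (T : finType) (le : rel T) (X : {set T}).
Hypotheses (leT_refl : reflexive le) (leT_trans : transitive le) (leT_anti : antisymmetric le).

Definition chain (A : pred T) : Prop :=
  (forall t, A t -> t \in X) /\ (forall t t', A t -> A t' -> le t t' || le t' t).

Definition chain_weight (f : T -> R) : Prop :=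
  [/\ forall t, 0 <= f t, \sum_t f t = 1 & chain (fun t => f t != 0)].

Definition weight (x : 'rV[R]_#|T|) (t : T) : R := x ord0 (enum_rank t).

Definition weight_vector (f : T -> R) : 'rV[R]_#|T| := \row_j f (enum_val j).

Lemma weight_point f t : weight (weight_vector f) t = f t.
Proof. by rewrite /weight mxE enum_rankK. Qed.

Lemma weight_inj x y : weight x =1 weight y -> x = y.
Proof.
by move=> h; apply/rowP => j; have := h (enum_val j); rewrite /weight enum_valK.
Qed.

Notation K := (realization R (order_complex le X)).

Lemma realizationP x : x \in K <-> chain_weight (weight x).
Proof.
rewrite inE; split=> -[h1 h2 h3]; split=> //.
  move: h3; rewrite inE => /andP[/fintype.subsetP hX /fintype.forall_inP h]; split=> t.
    by move=> ht; apply: hX; rewrite inE.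
  move=> t' ht ht'; have := h t; rewrite inE => /(_ ht) /fintype.forall_inP/(_ t').
  by rewrite inE; apply.
case: h3 => hX h; rewrite inE; apply/andP; split.
  by apply/fintype.subsetP => t; rewrite inE; apply: hX.
apply/fintype.forall_inP => t; rewrite inE => ht; apply/fintype.forall_inP => t'; rewrite inE.
exact: h.
Qed.

Lemma weight_realization (x : set_type K) : chain_weight (weight (\val x)).
Proof. exact/realizationP/valP. Qed.

Lemma point_realization f : chain_weight f -> weight_vector f \in K.
Proof.
by move=> h; apply/realizationP; rewrite (_ : weight _ = f) //; apply/funext/weight_point.
Qed.

Lemma cts_weight (t : T) : continuous (fun x : set_type K => weight (\val x) t).
Proof.
move=> x; apply: (@continuous_comp _ _ _ (fun y : set_type K => \val y)
  (fun M : 'rV[R]_#|T| => M ord0 (enum_rank t))).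
  exact: initial_continuous.
exact: coord_continuous.
Qed.

Section Descent.
Variable f : T -> T.
Hypothesis fX : forall a, a \in X -> f a \in X.
Hypothesis f_homo : forall a b, a \in X -> b \in X -> le a b -> le (f a) (f b).
Hypothesis f_le : forall a, a \in X -> le (f a) a.

(** The simplicial map induced by [f], in barycentric coordinates. *)
Definition push_weight (x : T -> R) (c : T) : R := \sum_(a | f a == c) x a.

(* At time [t], a mass [t] has been moved along [f], starting from the bottom of
   the chain: the support stays a chain because [f b <= b <= a] whenever the mass
   of [b] has started to move and that of [a] has not completely moved. *)
Definition moved (t : R) (x : T -> R) (a : T) : R :=
  Num.min (x a) (Num.max 0 (t - \sum_(b | (b != a) && le b a) x b)).

Definition descent (t : R) (x : T -> R) (c : T) : R :=
  x c - moved t x c + push_weight (moved t x) c.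

Lemma moved_ge0 t x a : (forall b, 0 <= x b) -> 0 <= moved t x a.
Proof. by move=> x0; rewrite le_min x0 le_max lexx. Qed.

Lemma moved_le t x a : moved t x a <= x a.
Proof. by rewrite ge_min lexx. Qed.

Lemma sum_push_weight x : \sum_c push_weight x c = \sum_a x a.
Proof.
rewrite /push_weight (exchange_big_dep xpredT) //=; apply: eq_bigr => a _.
by rewrite (bigD1 (f a)) //= big1 ?addr0 // => c /andP[/eqP -> ]; rewrite eqxx.
Qed.

Lemma push_weight_ge0 x c : (forall b, 0 <= x b) -> 0 <= push_weight x c.
Proof. by move=> x0; apply: sumr_ge0. Qed.

Lemma push_weight_supp x c : push_weight x c != 0 -> exists2 a, f a = c & x a != 0.
Proof.
move=> h; have [/existsP[a /andP[/eqP fa xa]]|/existsPn none] :=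
    boolP [exists a, (f a == c) && (x a != 0)]; first by exists a.
move: h; rewrite /push_weight big1 ?eqxx // => a fa.
by have := none a; rewrite fa /= negbK => /eqP.
Qed.

Lemma sum_below_lt (x : T -> R) a b : chain_weight x -> x a != 0 -> a != b -> le a b ->
  \sum_(c | (c != a) && le c a) x c + x a <= \sum_(c | (c != b) && le c b) x c.
Proof.
move=> [x0 _ _] xa ab lab; rewrite [leRHS](bigD1 a) /=; last by rewrite ab lab.
rewrite [leLHS]addrC lerD2l [leLHS]big_mkcond [leRHS]big_mkcond /=.
apply: ler_sum => c _; case: ifP => [/andP[ca lca]|_]; last by case: ifP.
rewrite ca andbT (leT_trans lca lab) andbT; case: eqP => //= cb.
have e : a = b by apply: leT_anti; rewrite lab -cb lca.
by rewrite e eqxx in ab.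
Qed.

Lemma descent_chain t x : chain_weight x -> chain_weight (descent t x).
Proof.
move=> cx; have [x0 x1 [xX xc]] := cx.
have m0 a : 0 <= moved t x a := moved_ge0 t a x0.
split.
- move=> c; rewrite addr_ge0 ?subr_ge0 ?moved_le //; exact: push_weight_ge0.
- by rewrite big_split /= sumrB sum_push_weight subrK.
have key c : descent t x c != 0 ->
    (moved t x c < x c /\ x c != 0) \/ (exists a, [/\ f a = c, x a != 0 & moved t x a != 0]).
  have [e|ne] := eqVneq (x c) (moved t x c); last first.
    move=> _; left; rewrite lt_neqAle eq_sym ne moved_le; split=> //.
    by apply: contra ne => /eqP e; rewrite eq_le moved_le andbT e m0.
  rewrite /descent -e subrr add0r => /push_weight_supp[a fa ma]; right; exists a; split=> //.
  by apply: contra ma => /eqP e'; rewrite eq_le m0 andbT (le_trans (moved_le t x a)) ?e'.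
(* If [a] were strictly below [b], the mass of [b] would start to move only after all that of [a]
   had moved. *)
have low a b : x a != 0 -> x b != 0 -> moved t x a < x a -> moved t x b != 0 -> le b a.
  move=> xa xb ma mb; have /orP[lab|//] := xc a b xa xb.
  have [<-//|ab] := eqVneq a b; exfalso.
  have h := sum_below_lt cx xa ab lab.
  have h1 : 0 < t - \sum_(c | (c != b) && le c b) x c.
    rewrite ltNge; apply: contra mb => h2; rewrite /moved.
    by rewrite (max_idPl h2) (min_idPr (x0 b)).
  move: ma; rewrite /moved gt_min ltxx /= gt_max => /andP[_]; lra.
split=> [c /key[[_ /xX //]|[a [<- /xX/fX //]]]|c d].
move=> /key[[mc xc0]|[a [<- xa ma]]] /key[[md xd0]|[b [<- xb mb]]].
- exact: xc.
- by rewrite (leT_trans (f_le (xX _ xb)) (low _ _ xc0 xb mc mb)) orbT.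
- by rewrite (leT_trans (f_le (xX _ xa)) (low _ _ xd0 xa md ma)).
- by have /orP[h|h] := xc a b xa xb; rewrite (f_homo _ _ h) ?xX ?orbT.
Qed.

Lemma descent0 x : chain_weight x -> descent 0 x =1 x.
Proof.
move=> [x0 _ _] c; have mz a : moved 0 x a = 0.
  rewrite /moved (max_idPl _); last by rewrite sub0r oppr_le0 sumr_ge0.
  exact/min_idPr.
by rewrite /descent mz subr0 /push_weight big1 ?addr0.
Qed.

Lemma descent1 x : chain_weight x -> descent 1 x =1 push_weight x.
Proof.
move=> [x0 x1 _] c; have mz a : moved 1 x a = x a.
  apply/min_idPl; rewrite le_max; apply/orP; right.
  rewrite lerBrDl -x1 [leRHS](bigD1 a) //= [leLHS]addrC lerD2l.
  rewrite [leLHS]big_mkcond [leRHS]big_mkcond /=; apply: ler_sum => b _.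
  by case: (b != a); case: (le b a).
by rewrite /descent mz subrr add0r; apply: eq_bigr => a _; rewrite mz.
Qed.

(* Any self-map whose value at [x] spans a simplex with the image of [x] under [f]
   is homotopic to the identity: push forward along [f], then move straight. *)
Lemma homotopic_id_descent (g : set_type K -> set_type K) : continuous g ->
  (forall x, chain (fun t => (weight (\val (g x)) t != 0) ||
                             (push_weight (weight (\val x)) t != 0))) ->
  homotopic R g idfun.
Proof.
move=> cg hg.
(* Time runs backwards from [idfun] at 1: the descent fills [1/2, 1], the straight segment to [g]
   fills [0, 1/2]. Clamping makes the formula meaningful at every real time, as the type of a
   homotopy demands. *)
pose t1 (t : R) := Num.max 0 (Num.min 1 (2 * (1 - t))).
pose t2 (t : R) := Num.max 0 (Num.min 1 (2 * (1 - t) - 1)).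
pose h (p : R * set_type K) (c : T) : R :=
  (1 - t2 p.1) * descent (t1 p.1) (weight (\val p.2)) c + t2 p.1 * weight (\val (g p.2)) c.
have t2_01 t : 0 <= t2 t <= 1.
  by rewrite /t2 le_max lexx /= ge_max ler01 /= ge_min lexx.
have t12 t : t2 t = 0 \/ t1 t = 1.
  rewrite /t1 /t2; have [h1|h1] := leP (2 * (1 - t) - 1) 0.
    by left; apply/max_idPl; rewrite ge_min h1 orbT.
  right; rewrite (min_idPl _) ?(max_idPr _) //; lra.
have hw p : chain_weight (h p).
  have cw := weight_realization p.2; have cgw := weight_realization (g p.2).
  have dw := descent_chain (t1 p.1) cw.
  have [e|e] := t12 p.1.
    rewrite (_ : h p = descent (t1 p.1) (weight (\val p.2))) //.
    by apply/funext => c; rewrite /h e subr0 mul1r mul0r addr0.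
  have /andP[u0 u1] := t2_01 p.1.
  case: cgw => g0 g1 _; case: (dw) => d0 d1 _; split.
  - by move=> c; rewrite addr_ge0 // mulr_ge0 // subr_ge0.
  - by rewrite big_split /= -!mulr_sumr d1 g1; ring.
  have [hX hc] := hg p.2.
  have sub c : h p c != 0 -> (weight (\val (g p.2)) c != 0) ||
      (push_weight (weight (\val p.2)) c != 0).
    apply: contraR; rewrite negb_or !negbK => /andP[/eqP z1 /eqP z2].
    by rewrite /h z1 e descent1 // z2 !mulr0 addr0.
  by split=> [c /sub /hX //|c d /sub sc /sub]; apply: hc.
exists (fun p => exist (fun y => y \in K) (weight_vector (h p)) (point_realization (hw p))).
have t1_cts : continuous (fun p : R * set_type K => t1 p.1).
  apply: cts_max; first exact: cts_cst.
  apply: cts_min; first exact: cts_cst.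
  apply: ctsM; first exact: cts_cst.
  by apply: ctsB; [apply: cts_cst | move=> x; apply: cvg_fst].
have t2_cts : continuous (fun p : R * set_type K => t2 p.1).
  apply: cts_max; first exact: cts_cst.
  apply: cts_min; first exact: cts_cst.
  apply: ctsB; last exact: cts_cst.
  apply: ctsM; first exact: cts_cst.
  by apply: ctsB; [apply: cts_cst | move=> x; apply: cvg_fst].
have w_cts a : continuous (fun p : R * set_type K => weight (\val p.2) a).
  move=> p; apply: (@continuous_comp _ _ _ snd (fun x : set_type K => weight (\val x) a)).
    exact: cvg_snd.
  exact: cts_weight.
have g_cts a : continuous (fun p : R * set_type K => weight (\val (g p.2)) a).
  move=> p; apply: (@continuous_comp _ _ _ (g \o snd) (fun x : set_type K => weight (\val x) a)).
    by apply: continuous_comp; [apply: cvg_snd | apply: cg].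
  exact: cts_weight.
have m_cts a : continuous (fun p : R * set_type K => moved (t1 p.1) (weight (\val p.2)) a).
  apply: cts_min => //; apply: cts_max; first exact: cts_cst.
  by apply: ctsB => //; apply: cts_sum.
split.
- apply: continuous_subspaceT; apply: cts_lift; apply: cts_rV => j.
  under eq_fun do rewrite mxE.
  apply: ctsD; apply: ctsM => //.
    by apply: ctsB => //; apply: cts_cst.
  apply: ctsD; first exact: ctsB.
  exact: cts_sum.
- move=> x; apply: val_inj; apply: weight_inj => c /=.
  rewrite weight_point /h /=.
  have -> : t2 0 = 1.
    by rewrite /t2 subr0 mulr1 (min_idPl _) ?(max_idPr _) //; lra.
  by rewrite subrr mul0r add0r mul1r.
- move=> x; apply: val_inj; apply: weight_inj => c /=.
  rewrite weight_point /h /=.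
  have -> : t2 1 = 0.
    by rewrite /t2 subrr mulr0 sub0r; apply/max_idPl; rewrite ge_min; apply/orP; right; lra.
  have -> : t1 1 = 0.
    by rewrite /t1 subrr mulr0; apply/max_idPl; rewrite ge_min lexx orbT.
  by rewrite subr0 mul1r mul0r addr0 descent0 //; apply: weight_realization.
Qed.

End Descent.
End OrderComplexHomotopy.

(** * Open intervals with a Boolean retract *)

Section Crosscut.
Variables (R : realType) (T K : finType) (le : rel T) (X : {set T}).
Variables (C : T -> Prop) (u v : T) (D : {set K}) (phi : T -> {set K}) (psi : {set K} -> T).
Hypotheses (leT_refl : reflexive le) (leT_trans : transitive le) (leT_anti : antisymmetric le).
Hypothesis XE : forall z, z \in X <-> [/\ C z, z != u & z != v].
Hypotheses (Cv : C v) (le_v : forall z, C z -> le z v) (uv : u != v).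
Hypothesis br : boolean_retract (fun x y => le x y) C u D phi psi.

Let clos (z : T) : T := psi (phi z).
Local Notation real := (realization R (order_complex le X)).

Let X_C z : z \in X -> C z. Proof. by case/XE. Qed.

Let phi_u : phi u = finset.set0.
Proof. by rewrite -(section_bot br) (sectionK br) // finset.sub0set. Qed.

Let psi_neq_u (A : {set K}) : A \subset D -> A != finset.set0 -> psi A != u.
Proof.
by move=> AD; apply: contra => /eqP e; rewrite -phi_u -e (sectionK br).
Qed.

Let phi_neq0 z : z \in X -> phi z != finset.set0.
Proof. by case/XE => Cz zu _; apply: contra zu => /eqP /(retract_bot br Cz) ->. Qed.

Let phi_D z : z \in X -> phi z \subset D.
Proof. by move=> /X_C; apply: (retract_sub br). Qed.

Let clos_homo a b : a \in X -> b \in X -> le a b -> le (clos a) (clos b).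
Proof.
move=> aX bX ab; apply: (section_homo br); first exact: phi_D.
by apply: (retract_homo br) => //; apply: X_C.
Qed.

Let clos_le a : a \in X -> le (clos a) a.
Proof. by move=> /X_C; apply: (section_le br). Qed.

Let clos_X a : a \in X -> clos a \in X.
Proof.
move=> aX; apply/XE; split; first exact/(section_in br)/phi_D.
  by apply: psi_neq_u; [apply: phi_D | apply: phi_neq0].
have [Ca _ av] := (XE a).1 aX; apply: contra av => /eqP e.
apply/eqP; apply: leT_anti; rewrite le_v //= -e.
exact: clos_le.
Qed.

Let chain_push_weight (x : T -> R) : chain_weight le X x ->
  chain le X (fun t => push_weight clos x t != 0).
Proof.
move=> [_ _ [xX xc]]; split=> [t /push_weight_supp[a <- /xX/clos_X //]|t t'].
move=> /push_weight_supp[a <- xa] /push_weight_supp[b <- xb].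
by have /orP[h|h] := xc a b xa xb; rewrite (clos_homo _ _ h) ?orbT ?xX.
Qed.

Let D_neq0 : D != finset.set0.
Proof.
apply: contra uv => /eqP D0; apply/eqP/esym/(retract_bot br Cv).
by apply/eqP; rewrite -finset.subset0 -D0; apply: (retract_sub br).
Qed.

(** Here [psi D] belongs to the open interval and dominates every [clos z], so the inequalities
    [z >= clos z <= psi D] contract the complex to a point. *)
Lemma realization_ball : psi D != v ->
  homotopy_equivalent R (set_type real) (set_type (unit_ball R 0)).
Proof.
move=> Dv; set c := psi D.
have cX : c \in X.
  by apply/XE; split=> //; [apply: (section_in br) | apply: psi_neq_u].
have cc : le c c by have := clos_le cX; rewrite /clos /c (sectionK br).
pose e (t : T) : R := (t == c)%:R.
have esupp t : e t != 0 -> t = c by rewrite /e; case: (t =P c) => // _; rewrite eqxx.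
have ew : chain_weight le X e.
  split=> [t||]; first by rewrite ler0n.
    by rewrite (bigD1 c) //= /e eqxx big1 ?addr0 // => t /negPf ->.
  split=> [t /esupp -> //|t t' /esupp -> /esupp ->].
  by rewrite cc.
have z0 : 0 \in unit_ball R 0 by rewrite inE /unit_ball /= big_ord0 ler01.
exists (fun=> exist (fun y => y \in unit_ball R 0) 0 z0).
exists (fun=> exist (fun y => y \in real) (weight_vector e) (point_realization ew)).
split; [exact: cst_continuous | exact: cst_continuous | |].
  apply: (homotopic_id_descent leT_refl leT_trans leT_anti (f := clos)) => //.
    exact: cst_continuous.
  move=> x /=; have cx := weight_realization x.
  have [pX pc] := chain_push_weight cx; have [_ _ [xX _]] := cx.
  have ec t : weight (weight_vector e) t != 0 -> t = c by rewrite weight_point; apply: esupp.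
  have pl t : push_weight clos (weight (\val x)) t != 0 -> le t c.
    case/push_weight_supp=> z <- /xX zX; apply: (section_homo br) => //.
    exact: phi_D.
  split=> [t /orP[/ec -> //|/pX //]|t t'].
  move=> /orP[/ec ->|pt] /orP[/ec ->|pt'].
  - by rewrite cc.
  - by rewrite pl ?orbT.
  - by rewrite pl.
  - exact: pc.
exists snd; split=> [|y|y //]; last first.
  by apply: val_inj; apply/rowP => -[].
by apply: continuous_subspaceT => x; apply: cvg_snd.
Qed.

Let d0 : K := xchoose (elimT (finset.set0Pn D) D_neq0).

Let d0D : d0 \in D. Proof. exact: (xchooseP (elimT (finset.set0Pn D) D_neq0)). Qed.

(** The sphere in dimension [n] space has dimension [#|D| - 2], that of the boundary of the simplex
    with vertex set [D]. For a singleton [D] it is empty. *)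
Let n : nat := #|D :\ d0|.

Let coord (l : 'I_n) : K := enum_val l.

Let coordD l : coord l \in D :\ d0. Proof. exact: enum_valP. Qed.

Let coord_surj k : k \in D -> k != d0 -> exists l, coord l = k.
Proof.
move=> kD kd; have kD' : k \in D :\ d0 by rewrite !inE kd.
by exists (enum_rank_in kD' k); rewrite /coord enum_rankK_in.
Qed.

(* A vector indexed by [D :\ d0] represents a function on [D] up to constants,
   normalised to vanish at [d0]. *)
Definition extend (r : 'rV[R]_n) (k : K) : R := \sum_l r ord0 l * (coord l == k)%:R.

Lemma extend_coord r l : extend r (coord l) = r ord0 l.
Proof.
rewrite /extend (bigD1 l) //= eqxx mulr1 big1 ?addr0 // => l' ll'.
by rewrite (inj_eq enum_val_inj) (negPf ll') mulr0.
Qed.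

Lemma extend_d0 r : extend r d0 = 0.
Proof.
rewrite /extend big1 // => l _; have := coordD l.
by rewrite !inE => /andP[/negPf -> _]; rewrite mulr0.
Qed.

(** The linear extension of [phi], with subsets of [D] seen as vertices of a cube. *)
Definition level (x : T -> R) (k : K) : R := \sum_t x t * (k \in phi t)%:R.

Definition level_row (x : T -> R) : 'rV[R]_n := \row_l (level x (coord l) - level x d0).

Lemma extend_level_row x k : k \in D -> extend (level_row x) k = level x k - level x d0.
Proof.
move=> kD; have [->|kd] := eqVneq k d0; first by rewrite extend_d0 subrr.
by have [l <-] := coord_surj kD kd; rewrite extend_coord mxE.
Qed.

Definition separated (y : K -> R) : Prop := exists i j, [/\ i \in D, j \in D & y j < y i].

Lemma extend_neq0 r : separated (extend r) -> r != 0.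
Proof.
move=> [i [j [_ _]]]; apply: contraTneq => ->.
by rewrite -leNgt /extend !big1 // => l _; rewrite mxE mul0r.
Qed.

Lemma separated_extend r : r != 0 -> separated (extend r).
Proof.
move=> r0; have [l rl] : exists l, r ord0 l != 0.
  apply/existsP; apply: contraNT r0; rewrite negb_exists => /forallP h.
  by apply/eqP/rowP => l; rewrite mxE; apply/eqP; have := h l; rewrite negbK.
have lD : coord l \in D by have := coordD l; rewrite !inE => /andP[].
have [lt|gt] : extend r (coord l) < extend r d0 \/ extend r d0 < extend r (coord l).
  by apply/orP; rewrite -neq_lt extend_coord extend_d0.
- by exists d0, (coord l).
- by exists (coord l), d0.
Qed.

(** Along a chain, each vertex has its atoms contained in [phi z] or containing it, so it counts for
    [i] at least as much as for [j]; [z] itself counts for [i] only. *)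
Lemma level_mono (x : T -> R) i j z : chain_weight le X x ->
  x z != 0 -> i \in phi z -> j \notin phi z -> level x j < level x i.
Proof.
move=> [x0 _ [xX xc]] xz iz jz; rewrite /level (bigD1 z) // [ltRHS](bigD1 z) //=.
rewrite iz (negPf jz) mulr0 mulr1; apply: ltr_leD; first by rewrite lt_neqAle eq_sym xz x0.
apply: ler_sum => t _; have [->|xt] := eqVneq (x t) 0; first by rewrite !mul0r.
apply: ler_wpM2l => //.
have sub a b : x a != 0 -> x b != 0 -> le a b -> phi a \subset phi b.
  by move=> /xX/X_C Ca /xX/X_C Cb; apply: (retract_homo br).
have /orP[h|h] := xc t z xt xz.
  have -> : (j \in phi t) = false; last by rewrite ler0n.
  by apply: contraNF jz; apply: (fintype.subsetP (sub _ _ xt xz h)).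
by rewrite (fintype.subsetP (sub _ _ xz xt h) _ iz) ler_nat leq_b1.
Qed.

(** * The case of a sphere *)

Section Sphere.
Hypothesis Dv : psi D = v.

Let phi_neqD z : z \in X -> phi z != D.
Proof.
move=> zX; have [Cz _ zv] := (XE z).1 zX; apply: contra zv => /eqP e.
by apply/eqP/leT_anti; rewrite le_v //= -Dv -e clos_le.
Qed.

Lemma level_separated (x : T -> R) : chain_weight le X x -> separated (level x).
Proof.
move=> cx; have [x0 x1 [xX _]] := cx.
have [z xz] : exists z, x z != 0.
  apply/existsP; apply: contraT; rewrite negb_exists => /forallP h.
  have := x1; rewrite big1 => [/eqP|t _]; first by rewrite eq_sym oner_eq0.
  by apply/eqP; have := h t; rewrite negbK.
have zX := xX z xz; have [i iz] := finset.set0Pn _ (phi_neq0 zX).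
have : phi z \proper D by rewrite finset.properEneq phi_neqD // phi_D.
case/fintype.properP => /fintype.subsetP sD [j jD jz].
by exists i, j; split=> //; [apply: sD | apply: level_mono cx xz iz jz].
Qed.

Definition proper_part (A : {set K}) : bool :=
  [&& A \subset D, A != finset.set0 & A != D].

Definition upper_level (y : K -> R) (A : {set K}) : Prop :=
  forall i j, i \in A -> j \in D :\: A -> y j < y i.

(** A continuous weight, positive exactly on the upper level sets of [y]. As these form a chain, the
    normalised gaps give a continuous map from the sphere to the order complex. *)
Definition gap (y : K -> R) (A : {set K}) : R :=
  \prod_(i in A) \prod_(j in D :\: A) Num.max 0 (y i - y j).

Lemma gap_ge0 y A : 0 <= gap y A.
Proof. by apply: prodr_ge0 => i _; apply: prodr_ge0 => j _; rewrite le_max lexx. Qed.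

Lemma gap_gt0 y A : upper_level y A -> 0 < gap y A.
Proof.
move=> h; apply: prodr_gt0 => i iA; apply: prodr_gt0 => j jA.
by rewrite lt_max subr_gt0 h ?orbT.
Qed.

Lemma gap_upper_level y A : gap y A != 0 -> upper_level y A.
Proof.
move=> h i j iA jA; rewrite ltNge; apply: contra h => yij.
rewrite /gap (bigD1 i) //= (bigD1 j) //= (max_idPl _) ?subr_le0 //.
by rewrite !mul0r.
Qed.

Definition total_gap (y : K -> R) : R := \sum_(A | proper_part A) gap y A.

Lemma ex_argmin (A : {set K}) (y : K -> R) k : k \in A ->
  exists2 i, i \in A & forall j, j \in A -> y i <= y j.
Proof.
move=> kA; case: (Order.TotalTheory.arg_minP y kA) => i iA h.
by exists i.
Qed.

Lemma ex_argmax (A : {set K}) (y : K -> R) k : k \in A ->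
  exists2 i, i \in A & forall j, j \in A -> y j <= y i.
Proof.
move=> kA; case: (Order.TotalTheory.arg_maxP y kA) => i iA h.
by exists i.
Qed.

Lemma total_gap_gt0 y : separated y -> 0 < total_gap y.
Proof.
move=> [i [j [iD jD ij]]]; have [j0 j0D hj0] := ex_argmin y jD.
pose A := [set k in D | y j0 < y k]%SET.
have pA : proper_part A.
  apply/and3P; split.
  - by apply/fintype.subsetP => k; rewrite inE => /andP[].
  - by apply/finset.set0Pn; exists i; rewrite inE iD (le_lt_trans (hj0 j jD) ij).
  - by apply/eqP => /setP/(_ j0); rewrite inE ltxx j0D.
rewrite /total_gap (bigD1 A) //=; apply: ltr_pwDl.
  apply: gap_gt0 => k l; rewrite !inE => /andP[kD hk] /andP[hl lD].
  by apply: le_lt_trans hk; move: hl; rewrite lD /= -leNgt.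
by apply: sumr_ge0 => B _; apply: gap_ge0.
Qed.

Definition section_weight (y : K -> R) (t : T) : R :=
  \sum_(A | proper_part A && (psi A == t)) gap y A / total_gap y.

Lemma section_weight_supp y t : section_weight y t != 0 ->
  exists A, [/\ proper_part A, psi A = t & upper_level y A].
Proof.
move=> h; have [/existsP[A /and3P[pA /eqP At gA]]|/existsPn none] :=
    boolP [exists A, [&& proper_part A, psi A == t & gap y A != 0]].
  by exists A; split=> //; apply: gap_upper_level.
move: h; rewrite /section_weight big1 ?eqxx // => A /andP[pA At].
have := none A; rewrite pA At /= negbK => /eqP ->; by rewrite mul0r.
Qed.

Lemma section_weight_chain y : separated y -> chain_weight le X (section_weight y).
Proof.
move=> sy; have g0 := total_gap_gt0 sy; split.
- by move=> t; apply: sumr_ge0 => A _; rewrite divr_ge0 ?gap_ge0 ?ltW.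
- rewrite /section_weight (exchange_big_dep proper_part) /=; last by move=> t A _ /andP[].
  transitivity (\sum_(A | proper_part A) gap y A / total_gap y).
    apply: eq_bigr => A pA; apply: big_pred1 => t.
    by rewrite /= pA eq_sym.
  by rewrite -mulr_suml divff ?gt_eqF.
split=> [t /section_weight_supp[A [/and3P[AD A0 AnD] <- _]]|t t'].
  apply/XE; split; [exact: (section_in br) | exact: psi_neq_u |].
  apply: contra AnD => /eqP; rewrite -Dv => /(congr1 phi).
  by rewrite !(sectionK br) // => ->.
move=> /section_weight_supp[A [/and3P[AD _ _] <- uA]].
move=> /section_weight_supp[B [/and3P[BD _ _] <- uB]].
(* Two upper level sets are comparable: [i] in [A] only and [j] in [B] only would each have the
   larger value. *)
have [AB|/fintype.subsetPn[i iA iB]] := boolP (A \subset B).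
  by rewrite (section_homo br BD AB).
have [BA|/fintype.subsetPn[j jB jA]] := boolP (B \subset A).
  by rewrite (section_homo br AD BA) orbT.
have := uA i j iA; rewrite inE jA (fintype.subsetP BD _ jB) => /(_ isT).
have := uB j i jB; rewrite inE iB (fintype.subsetP AD _ iA) => /(_ isT).
by move=> h1 h2; have := lt_trans h1 h2; rewrite ltxx.
Qed.

Lemma level_section_weight y k : level (section_weight y) k =
  \sum_(A | proper_part A) gap y A / total_gap y * (k \in A)%:R.
Proof.
rewrite /level /section_weight.
under eq_bigr do rewrite mulr_suml.
rewrite (exchange_big_dep proper_part) /=; last by move=> t A _ /andP[].
apply: eq_bigr => A pA; rewrite (big_pred1 (psi A)) => [|t].
  by rewrite (sectionK br) //; case/and3P: pA.
by rewrite /= pA eq_sym.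
Qed.

(** Take [i] lowest in [A] and [j] highest outside. Some vertex [z] must contain [i] and not [j], or
    [level x i] would not exceed [level x j]; by [level_mono] and extremality its atoms are exactly
    [A]. *)
Lemma upper_level_level (x : T -> R) A : chain_weight le X x -> proper_part A ->
  upper_level (level x) A -> exists2 z, x z != 0 & phi z = A.
Proof.
move=> cx /and3P[AD A0 AnD] uA; have [x0 _ [xX _]] := cx.
have [i0 i0A] := finset.set0Pn _ A0.
have : A \proper D by rewrite finset.properEneq AnD.
case/fintype.properP => _ [j1 j1D j1A].
have j1DA : j1 \in D :\: A by rewrite inE j1A.
have [i iA hi] := ex_argmin (level x) i0A.
have [j jDA hj] := ex_argmax (level x) j1DA.
have [/existsP[z /and3P[xz iz jz]]|/existsPn none] :=
  boolP [exists z, [&& x z != 0, i \in phi z & j \notin phi z]].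
  exists z => //; apply/eqP; rewrite finset.eqEsubset; apply/andP; split.
    apply/fintype.subsetP => k kz; apply: contraT => kA.
    have kDA : k \in D :\: A by rewrite inE kA (fintype.subsetP (phi_D (xX z xz))).
    by have := hj k kDA; rewrite leNgt (level_mono cx xz kz jz).
  apply/fintype.subsetP => k kA; apply: contraT => kz.
  by have := hi k kA; rewrite leNgt (level_mono cx xz iz kz).
exfalso; have := uA i j iA jDA; rewrite ltNge => /negP; apply.
apply: ler_sum => z _; have [->|xz] := eqVneq (x z) 0; first by rewrite !mul0r.
apply: ler_wpM2l => //; have := none z; rewrite xz /= negb_and negbK.
by case/orP => [/negPf ->|->]; rewrite ?ler0n // ler_nat leq_b1.
Qed.

Definition norm2 (r : 'rV[R]_n) : R := Num.sqrt (\sum_l r ord0 l ^+ 2).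

Lemma norm2_gt0 r : r != 0 -> 0 < norm2 r.
Proof.
move=> r0; rewrite sqrtr_gt0 lt_neqAle eq_sym; apply/andP; split; last first.
  by apply: sumr_ge0 => l _; apply: sqr_ge0.
apply: contra r0; rewrite psumr_eq0; last by move=> l _; apply: sqr_ge0.
move=> /allP h; apply/eqP/rowP => l; rewrite mxE; apply/eqP.
by have /= := h l (mem_index_enum l); rewrite sqrf_eq0.
Qed.

Definition normalize (r : 'rV[R]_n) : 'rV[R]_n := \row_l (r ord0 l / norm2 r).

Notation sph := (unit_sphere R n).

Lemma normalize_sphere r : r != 0 -> normalize r \in sph.
Proof.
move=> /norm2_gt0 h; rewrite inE /unit_sphere /=.
under eq_bigr do rewrite mxE expr_div_n.
rewrite -mulr_suml sqr_sqrtr ?divff //; last by apply: sumr_ge0 => l _; apply: sqr_ge0.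
by apply: contraTneq h => e; rewrite /norm2 e sqrtr0 ltxx.
Qed.

Lemma sphere_neq0 (r : set_type sph) : \val r != 0.
Proof.
have := valP r; rewrite inE /unit_sphere /=; apply: contra_eqN => /eqP ->.
rewrite big1 => [|l _]; first by rewrite eq_sym oner_eq0.
by rewrite mxE expr0n.
Qed.

Lemma normalize_id (r : set_type sph) : normalize (\val r) = \val r.
Proof.
have := valP r; rewrite inE /unit_sphere /= => h.
by apply/rowP => l; rewrite mxE /norm2 h sqrtr1 divr1.
Qed.

Lemma extend_normalize r k : extend (normalize r) k = extend r k / norm2 r.
Proof.
rewrite /extend mulr_suml; apply: eq_bigr => l _; rewrite mxE; ring.
Qed.

Lemma level_row_neq0 (x : T -> R) : chain_weight le X x -> level_row x != 0.
Proof.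
move=> /level_separated[i [j [iD jD h]]]; apply: extend_neq0; exists i, j; split=> //.
by rewrite !extend_level_row // ltrD2r.
Qed.

Let to_sphere (x : set_type real) : set_type sph :=
  exist (fun y => y \in sph) _
    (normalize_sphere (level_row_neq0 (weight_realization x))).

Let of_sphere (r : set_type sph) : set_type real :=
  exist (fun y => y \in real) _
    (point_realization (section_weight_chain (separated_extend (sphere_neq0 r)))).

(** An index where [r] is maximal lies in every proper upper level set, one where it is minimal in
    none. Their levels are 1 and 0, so both ends of the segment separate these indices in the same
    direction and the segment avoids the origin. *)
Lemma to_of_sphere_neq0 (r : set_type sph) (t : R) : 0 <= t <= 1 ->
  (1 - t) *: level_row (weight (\val (of_sphere r))) + t *: \val r != 0.
Proof.
move=> /andP[t0 t1]; set w := (X in X != 0).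
have sr := separated_extend (sphere_neq0 r).
have Ew k : k \in D -> extend w k = (1 - t) * (level (weight (\val (of_sphere r))) k
    - level (weight (\val (of_sphere r))) d0) + t * extend (\val r) k.
  move=> kD; rewrite -extend_level_row // /extend !mulr_sumr -big_split /=.
  by apply: eq_bigr => l _; rewrite !mxE; ring.
have [i1 [j1 [i1D j1D h1]]] := sr.
have [i iD hi] := ex_argmax (extend (\val r)) i1D.
have [j jD hj] := ex_argmin (extend (\val r)) j1D.
have hij : extend (\val r) j < extend (\val r) i.
  by apply: le_lt_trans (hj _ j1D) _; apply: lt_le_trans h1 (hi _ i1D).
apply: extend_neq0; exists i, j; split=> //; rewrite !Ew //.
have wE : weight (\val (of_sphere r)) = section_weight (extend (\val r)).
  by apply/funext => c; rewrite /of_sphere /= weight_point.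
have gt0 := total_gap_gt0 sr.
have li : level (weight (\val (of_sphere r))) i = 1.
  rewrite wE level_section_weight.
  transitivity (\sum_(A | proper_part A) gap (extend (\val r)) A / total_gap (extend (\val r))).
    apply: eq_bigr => A /and3P[AD A0 AnD].
    have [->|/gap_upper_level uA] := eqVneq (gap (extend (\val r)) A) 0; first by rewrite !mul0r.
    have -> : i \in A; last by rewrite mulr1.
    apply: contraT => iA; have [k kA] := finset.set0Pn _ A0.
    have := uA k i kA; rewrite inE iA iD => /(_ isT).
    by rewrite ltNge hi // (fintype.subsetP AD).
  by rewrite -mulr_suml divff ?gt_eqF.
have lj : level (weight (\val (of_sphere r))) j = 0.
  rewrite wE level_section_weight big1 // => A /and3P[AD A0 AnD].
  have [->|/gap_upper_level uA] := eqVneq (gap (extend (\val r)) A) 0; first by rewrite !mul0r.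
  have -> : (j \in A) = false; last by rewrite mulr0.
  apply/negP => jA.
  have : A \proper D by rewrite finset.properEneq AnD.
  case/fintype.properP => _ [k kD kA].
  have := uA j k jA; rewrite inE kA kD => /(_ isT).
  by rewrite ltNge hj.
rewrite li lj; set a := level _ d0; set x := extend _ j; set y := extend _ i in hij *.
have [->|tn] := eqVneq t 0; first lra.
have tp : 0 < t by rewrite lt_neqAle eq_sym tn.
have : t * x < t * y by rewrite ltr_pM2l.
by lra.
Qed.

Lemma cts_level_row (S : topologicalType) (x : S -> T -> R) :
  (forall t, continuous (fun q => x q t)) -> 
  forall l, continuous (fun q => level_row (x q) ord0 l).
Proof.
move=> cx l; under eq_fun do rewrite mxE.
by apply: ctsB; apply: cts_sum => t _; apply: ctsM => //; apply: cts_cst.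
Qed.

Lemma cts_normalize (S : topologicalType) (r : S -> 'rV[R]_n) :
  (forall q, r q != 0) -> (forall l, continuous (fun q => r q ord0 l)) ->
  continuous (fun q => normalize (r q)).
Proof.
move=> r0 cr; apply: cts_rV => l; under eq_fun do rewrite mxE.
apply: ctsM => //; apply: ctsV => [q|]; first by rewrite gt_eqF // norm2_gt0.
by apply: cts_sqrt; apply: cts_sum => k _; apply: ctsM.
Qed.

Let cts_val_sphere l : continuous (fun r : set_type sph => \val r ord0 l).
Proof.
move=> x; apply: (@continuous_comp _ _ _ (fun y : set_type sph => \val y)
  (fun M : 'rV[R]_n => M ord0 l)); first exact: initial_continuous.
exact: coord_continuous.
Qed.

Let cts_to_sphere : continuous to_sphere.
Proof.
apply: cts_lift; apply: cts_normalize => [x|].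
  exact/level_row_neq0/weight_realization.
by apply: cts_level_row => t; apply: cts_weight.
Qed.

Let cts_of_sphere : continuous of_sphere.
Proof.
have ce k : continuous (fun r : set_type sph => extend (\val r) k).
  by apply: cts_sum => l _; apply: ctsM => //; apply: cts_cst.
have cg A : continuous (fun r : set_type sph => gap (extend (\val r)) A).
  apply: cts_prod => i _; apply: cts_prod => j _; apply: cts_max; first exact: cts_cst.
  exact: ctsB.
apply: cts_lift; apply: cts_rV => l; under eq_fun do rewrite mxE.
apply: cts_sum => A _; apply: ctsM => //; apply: ctsV => [r|].
  by rewrite gt_eqF // total_gap_gt0 //; apply/separated_extend/sphere_neq0.
exact: cts_sum.
Qed.

Lemma realization_sphere :
  homotopy_equivalent R (set_type real) (set_type sph).
Proof.
exists to_sphere, of_sphere; split=> //.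
  apply: (homotopic_id_descent leT_refl leT_trans leT_anti (f := clos)) => //.
    by move=> x; apply: continuous_comp; [apply: cts_to_sphere | apply: cts_of_sphere].
  move=> x; have cx := weight_realization x; have [x0 _ [xX _]] := cx.
  set g := weight _.
  (* Returning from the sphere only uses closures of vertices of [x]: normalising and subtracting
     the level at [d0] do not change the upper level sets. *)
  have sub t : g t != 0 -> push_weight clos (weight (\val x)) t != 0.
    rewrite /g /= weight_point => /section_weight_supp[A [pA <- uA]].
    have AD : A \subset D by case/and3P: pA.
    have N0 := norm2_gt0 (level_row_neq0 cx).
    have uA' : upper_level (level (weight (\val x))) A.
      move=> i j iA jA; have := uA i j iA jA.
      have iD := fintype.subsetP AD _ iA.
      have jD : j \in D by move: jA; rewrite inE => /andP[].
      by rewrite !extend_normalize !extend_level_row // ltr_pM2r ?invr_gt0 // ltrD2r.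
    have [z xz <-] := upper_level_level cx pA uA'.
    apply: lt0r_neq0; rewrite /push_weight (bigD1 z) //=.
    by rewrite ltr_pwDl ?sumr_ge0 // lt_neqAle eq_sym xz x0.
  have [pX pc] := chain_push_weight cx.
  have sub' t : (g t != 0) || (push_weight clos (weight (\val x)) t != 0) ->
      push_weight clos (weight (\val x)) t != 0 by case/orP => // /sub.
  by split=> [t /sub' /pX //|t t' /sub' pt /sub' pt']; apply: pc.
(* On the sphere side, a straight segment normalised at each clamped time is a homotopy. *)
pose cl (t : R) := Num.max 0 (Num.min 1 t).
have cl01 t : 0 <= cl t <= 1.
  by rewrite /cl le_max lexx /= ge_max ler01 /= ge_min lexx.
pose h (p : R * set_type sph) :=
  (1 - cl p.1) *: level_row (weight (\val (of_sphere p.2))) + cl p.1 *: \val p.2.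
have h0 p : h p != 0 by apply: to_of_sphere_neq0.
exists (fun p => exist (fun y => y \in sph) _ (normalize_sphere (h0 p))); split.
- apply: continuous_subspaceT; apply: cts_lift; apply: cts_normalize => // l.
  rewrite (_ : (fun p => _) = (fun p => (1 - cl p.1) *
    level_row (weight (\val (of_sphere p.2))) ord0 l + cl p.1 * \val p.2 ord0 l)); last first.
    by apply/funext => p; rewrite /h !mxE.
  have c_cl : continuous (fun p : R * set_type sph => cl p.1).
    apply: cts_max; first exact: cts_cst.
    apply: cts_min; first exact: cts_cst.
    by move=> x; apply: cvg_fst.
  have c_lev : continuous (fun p : R * set_type sph =>
      level_row (weight (\val (of_sphere p.2))) ord0 l).
    apply: cts_level_row => t x.
    apply: (@continuous_comp _ _ _ (of_sphere \o snd) (fun y : set_type real => weight (\val y) t)).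
      by apply: continuous_comp; [apply: cvg_snd | apply: cts_of_sphere].
    exact: cts_weight.
  have c_val : continuous (fun p : R * set_type sph => \val p.2 ord0 l).
    move=> x; apply: (@continuous_comp _ _ _ snd (fun y : set_type sph => \val y ord0 l)).
      exact: cvg_snd.
    exact: cts_val_sphere.
  apply: ctsD; apply: ctsM => //; apply: ctsB => //; exact: cts_cst.
- move=> r; apply: val_inj => /=; rewrite /h /=.
  have -> : cl 0 = 0 by rewrite /cl (min_idPr _) ?ler01 // maxxx.
  by rewrite subr0 scale1r scale0r addr0.
- move=> r; apply: val_inj => /=; rewrite /h /=.
  have -> : cl 1 = 1 by rewrite /cl minxx (max_idPr _) ?ler01.
  by rewrite subrr scale0r scale1r add0r normalize_id.
Qed.

End Sphere.

Theorem realization_ball_or_sphere : exists k,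
  homotopy_equivalent R (set_type real) (set_type (unit_ball R k)) \/
  homotopy_equivalent R (set_type real) (set_type (unit_sphere R k)).
Proof.
have [e|ne] := eqVneq (psi D) v; first by exists n; right; apply: realization_sphere.
by exists 0%N; left; apply: realization_ball.
Qed.

End Crosscut.

Theorem theorem5p8 (R : realType) (I : finType) (W : finGroupType)
    (m : I -> I -> nat) (s : I -> W) (hW : coxeter_system m s)
    (c : W) (a : seq I) (hc : coxeter_word s c a)
    (u v : W) (hu : sortable s a u) (hv : sortable s a v)
    (huv : weak_lt s u v) :
  let X := realization R
    (order_complex (weak_le s) (cambrian_interval s a u v)) in
  exists n : nat,
    homotopy_equivalent R (set_type X) (set_type (unit_ball R n)) \/
    homotopy_equivalent R (set_type X) (set_type (unit_sphere R n)).
Proof.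
have ha : perm_eq a (enum I) := hc.1.
have ua : uniq a by rewrite (perm_uniq ha) enum_uniq.
have wP x y : weak_le s x y <-> wle R m s x y := weak_leP R hW x y.
have sP w : sortable s a w <-> srt s a w := sortable_srt R hW ha w.
case/andP: huv => uv /wP luv.
have [D [phi [psi [br _]]]] :=
  srt_boolean_retract hW ua ((sP u).1 hu) ((sP v).1 hv) luv.
have leE : wle R m s = (fun x y => weak_le s x y : Prop).
  by apply/funext => x; apply/funext => y; apply/propext; split=> /wP.
rewrite leE in br.
apply: (realization_ball_or_sphere R (C := srt_interval R m s a u v) _ _ _ _ _ _ uv br).
- by move=> x; apply/wP.
- by move=> y x z /wP xy /wP yz; apply/wP; apply: wle_trans yz.
- by move=> x y /andP[/wP xy /wP yx]; apply: (wle_anti hW) xy yx.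
- move=> z; rewrite inE /weak_lt; split.
    case/and3P=> /asboolP /sP sz /andP[uz /wP lz] /andP[zv /wP lv].
    by split=> //; rewrite eq_sym.
  move=> [[sz /wP lz /wP lv] zu zv]; rewrite eq_sym zu zv lz lv !andbT.
  by apply/asboolP/sP.
- by split=> //; apply/sP.
- by move=> z [_ _ /wP].
Qed.
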